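(* Let $n,k,r$ be integers such that $k\geq 1$, $r\geq 2$, and $n\geq 256(k+1)^5r^{16}$. Then $$ar(n,F_{k+1,r})=\mathrm{ex}(n,F_{k,r})+2.$$
   Context: All graphs are finite and simple. For integers $k\ge 1$, $r\ge 2$, the $(k,r)$-fan $F_{k,r}$ is the graph on $(r-1)k+1$ vertices consisting of $k$ cliques, each with $r$ vertices, which intersect in exactly one common vertex (any two of the cliques share only that vertex). The Turán number $\mathrm{ex}(n,G)$ is the maximum number of edges of a graph on $n$ vertices containing no subgraph isomorphic to $G$ (not necessarily induced). An edge-coloring of a graph with exactly $m$ colors is an assignment of $m$ colors to its edges (adjacent edges may receive the same color) in which all $m$ colors are used. An edge-colored graph is rainbow if all its edges have distinct colors. The anti-Ramsey number $ar(n,G)$ is the minimum number of colors $m$ such that each edge-coloring of the complete graph $K_n$ with exactly $m$ colors contains a rainbow copy of $G$ (as a subgraph, not necessarily induced). *)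

(* Defs.v *)
From HB Require Import structures.
From mathcomp Require Import all_boot.

Set Implicit Arguments.
Unset Strict Implicit.
Unset Printing Implicit Defensive.

(* A finite simple graph on the vertex set V is a set of 2-element subsets
   of V; #|H| is then the number of edges of H. *)
Record sgraph (V : finType) : Type := SGraph {
  edges :> {set {set V}};
  edges_pairs : edges \subset [set e : {set V} | #|e| == 2] }.

HB.instance Definition _ (V : finType) := [isSub for @edges V].
HB.instance Definition _ (V : finType) := [Finite of sgraph V by <:].

Definition complete (V : finType) : sgraph V := SGraph (subxx _).

Definition clique (k r : nat) (i : 'I_k) : {set option ('I_k * 'I_r.-1)} :=
  None |: [set Some (i, j) | j : 'I_r.-1].

Definition fan_edges (k r : nat) : {set {set option ('I_k * 'I_r.-1)}} :=
  [set e : {set option ('I_k * 'I_r.-1)} |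
    (#|e| == 2) && [exists i : 'I_k, e \subset clique r i]].

Lemma fan_edges_pairs (k r : nat) :
  fan_edges k r \subset [set e : {set option ('I_k * 'I_r.-1)} | #|e| == 2].
Proof. by apply/subsetP => e; rewrite !inE => /andP[]. Qed.

(* F_{k,r} for r >= 2: None is the common vertex of the k cliques, and
   Some (i, j) is the j-th of the r - 1 other vertices of the i-th clique. *)
Definition fan (k r : nat) : sgraph (option ('I_k * 'I_r.-1)) :=
  SGraph (fan_edges_pairs k r).

Definition copy_edges (V W : finType) (G : sgraph V) (f : {ffun V -> W}) :
    {set {set W}} :=
  [set f @: (e : {set V}) | e in edges G].

Definition is_copy (V W : finType) (H : sgraph W) (G : sgraph V)
    (f : {ffun V -> W}) : bool :=
  injectiveb f && (copy_edges G f \subset edges H).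

Definition contains (V W : finType) (H : sgraph W) (G : sgraph V) : bool :=
  [exists f : {ffun V -> W}, is_copy H G f].

(* The maximum is over a nonempty family as soon as G has an edge. *)
Definition ex (n : nat) (V : finType) (G : sgraph V) : nat :=
  \max_(H : sgraph 'I_n | ~~ contains H G) #|edges H|.

(* A coloring of the edges of K_n is given by a function on all subsets of
   'I_n, of which only the values on 2-element subsets are ever used. *)
Definition exact_coloring (n m : nat) (c : {ffun {set 'I_n} -> 'I_m}) : bool :=
  c @: edges (complete 'I_n) == [set: 'I_m].

Definition has_rainbow (n m : nat) (c : {ffun {set 'I_n} -> 'I_m})
    (V : finType) (G : sgraph V) : bool :=
  [exists f : {ffun V -> 'I_n},
    is_copy (complete 'I_n) G f && dinjectiveb c (mem (copy_edges G f))].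

(* The number of colors is required to be positive: for n >= 2 there is no
   coloring with exactly 0 colors, so m = 0 would qualify vacuously. *)
Definition forces_rainbow (n : nat) (V : finType) (G : sgraph V) (m : nat) :
    bool :=
  (0 < m) &&
  [forall c : {ffun {set 'I_n} -> 'I_m},
    exact_coloring c ==> has_rainbow c G].

Lemma forces_rainbow_exists (n : nat) (V : finType) (G : sgraph V) :
  exists m, forces_rainbow n G m.
Proof.
exists #|{set 'I_n}|.+1; apply/andP; split=> //.
apply/forallP => c; apply/implyP => /eqP surj_c.
have := leq_trans (leq_imset_card c (mem (edges (complete 'I_n))))
                  (max_card _).
by rewrite surj_c cardsT card_ord ltnn.
Qed.

Definition ar (n : nat) (V : finType) (G : sgraph V) : nat :=
  ex_minn (forces_rainbow_exists n G).

(* Main.v *)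
Require Import Defs.
From mathcomp Require Import all_boot.
From mathcomp Require Import zify.

Set Implicit Arguments.
Unset Strict Implicit.
Unset Printing Implicit Defensive.

(** Lower bound. Give distinct colours to the edges of an extremal graph without
the fan with [k] cliques, and one more colour to all the other pairs. A
rainbow fan with [k + 1] cliques has at most one edge of the last colour, so
[k] of its cliques are in the extremal graph ([forcing_ge]).

Upper bound, for cliques of [q + 1] vertices with [q >= 2]. Suppose that a
colouring with [ex + 2] colours has no rainbow fan with [k + 1] cliques. Any
graph made of edges of distinct colours has no such fan. After the removal of
the vertices of small colour degree ([large_core]), a graph [G] with one edge
of each remaining colour has the minimum degree of a Turan graph, and this
forces a partition in [q] parts such that each vertex misses few vertices of
the other parts ([near_partition]). Then a fan is essentially the same thing
as its seeds: edges at the centre inside its part, and disjoint edges inside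
the other parts ([fan_seeds], [seeds_fan]).

Call a colour popular in a part if it appears there on pairs of vertices
joined to all the other parts, whatever few vertices are deleted. Every part
has a popular colour, since otherwise it would have a large rainbow matching,
hence a rainbow fan centred in another part ([popular_exists]). A pair of a
popular colour is a free seed for every centre in another part. If two parts
had the same popular colour, the graph [G] without this colour would therefore
have no fan with [k] cliques; it could be extended to all the vertices, and
would have more edges than the extremal number allows ([popular_distinct]).

So two parts have distinct popular colours. Let [H] be [G] without them. It is
fan-free for [k], and moreover a generic vertex as centre can use both popular
colours at once, so the matching numbers of the inner graphs of the parts
other than a given one have a sum at most [k - 2] ([off_matching_two]). An
edge count in terms of degrees and matching numbers, which rests on Gallai's
lemma and the Tutte-Berge formula ([weighted_edge_bound], [matching_weights]),
shows that [H] has fewer than [(k - 1) ^ 2] inner edges more than it has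
missing cross pairs. But a complete bipartite graph with [k - 1] vertices on
each side, put inside one part of a complete multipartite graph, contains no
fan with [k] cliques ([cross_bipartite_fan_free]), so the extremal number
exceeds the size of the complete multipartite graph by at least [(k - 1) ^ 2];
this is a contradiction ([too_many_colors]).

For [q = 1] the fans are stars, and each vertex sees at most [k] colours. A
count shows that some colour is seen by all the vertices; the other colours
then make a graph of maximum degree less than [k] ([star_colors_bound]). *)

(** * Disjoint families of sets *)

Section Families.
Variable V : finType.
Implicit Types (P Q M : {set {set V}}) (A X e : {set V}).

Lemma trivIset_eq P A B x :
  trivIset P -> A \in P -> B \in P -> x \in A -> x \in B -> A = B.
Proof.
move=> /trivIsetP tP PA PB xA xB; apply/eqP; case: (A =P B) => // /eqP nAB.
by have /disjointFr/(_ xA) := tP _ _ PA PB nAB; rewrite xB.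
Qed.

Lemma trivIset_intro P :
  (forall A B x, A \in P -> B \in P -> x \in A -> x \in B -> A = B) ->
  trivIset P.
Proof.
move=> eqP'; apply/trivIsetP => A B PA PB /eqP nAB.
rewrite -setI_eq0; apply/set0Pn => -[x /setIP[xA xB]].
exact: nAB (eqP' _ _ _ PA PB xA xB).
Qed.

Lemma trivIset_add P A : trivIset P -> [disjoint A & cover P] ->
  trivIset (A |: P).
Proof.
move=> tP dAP.
have cAB B x : B \in P -> x \in A -> x \in B -> False.
  move=> PB xA xB; have /disjointFr/(_ xA) := dAP.
  by have -> : x \in cover P by apply/bigcupP; exists B.
apply: trivIset_intro => B C x /setU1P[->|PB] /setU1P[->|PC] // xB xC.
- by case: (cAB _ _ PC xB xC).
- by case: (cAB _ _ PB xC xB).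
exact: trivIset_eq tP PB PC xB xC.
Qed.

Lemma card_add P A x :
  x \in A -> [disjoint A & cover P] -> #|A |: P| = #|P|.+1.
Proof.
move=> xA dAP; rewrite cardsU1; case: (boolP (A \in P)) => //= PA.
have /disjointFr/(_ xA) := dAP.
by have -> : x \in cover P by apply/bigcupP; exists A.
Qed.

Lemma leq_hitting P X :
  trivIset P -> (forall e, e \in P -> exists2 x, x \in e & x \in X) ->
  #|P| <= #|X|.
Proof.
move=> tP hit.
have /fin_all_exists[g gP] (e : {set V}) :
    exists y : option V, e \in P ->
      exists x, [/\ y = Some x, x \in e & x \in X].
  case: (boolP (e \in P)) => [/hit[x xe xX]|_]; last by exists None.
  by exists (Some x) => _; exists x.
have g_inj : {in P &, injective g}.
  move=> e1 e2 Pe1 Pe2; have [x [-> xe1 _]] := gP _ Pe1.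
  by have [y [-> ye2 _]] := gP _ Pe2 => -[exy]; apply: trivIset_eq tP _ _ xe1 _; rewrite // exy.
rewrite -(card_in_imset g_inj) -(card_imset (mem X) (@Some_inj _)).
apply/subset_leq_card/subsetP => _ /imsetP[e /gP[x [-> _ xX]] ->].
exact: imset_f.
Qed.

Lemma card_cover_le P s : (forall e, e \in P -> #|e| <= s) ->
  #|cover P| <= #|P| * s.
Proof.
move=> ub; have [le1 _] := leq_card_cover P; apply: leq_trans le1 _.
by rewrite -sum_nat_const; apply: leq_sum.
Qed.

Lemma card_cover_eq P s : trivIset P -> (forall e, e \in P -> #|e| = s) ->
  #|cover P| = #|P| * s.
Proof.
rewrite /trivIset => /eqP <- eqs.
by rewrite -sum_nat_const; apply: eq_bigr.
Qed.

Lemma trivIset_shrink P (g : {set V} -> {set V}) : trivIset P ->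
  (forall e, e \in P -> g e \subset e) ->
  (forall e, e \in P -> exists x, x \in g e) ->
  trivIset (g @: P) /\ #|g @: P| = #|P|.
Proof.
move=> tP sg g0; split.
  apply: trivIset_intro => _ _ x /imsetP[e Pe ->] /imsetP[f Pf ->] xe xf.
  by congr g; apply: trivIset_eq tP Pe Pf (subsetP (sg _ Pe) _ xe)
                                  (subsetP (sg _ Pf) _ xf).
apply: card_in_imset => e f Pe Pf gef; have [x xe] := g0 _ Pe.
apply: (trivIset_eq tP Pe Pf (subsetP (sg _ Pe) _ xe)).
by apply: (subsetP (sg _ Pf)); rewrite -gef.
Qed.

Lemma subset_of_card A s : s <= #|A| -> exists2 B : {set V}, B \subset A & #|B| = s.
Proof.
elim: s => [|s IH] sA; first by exists set0; rewrite ?sub0set ?cards0.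
have [B sBA Bs] := IH (ltnW sA).
have /set0Pn[x /setDP[xA xB]] : A :\: B != set0.
  by rewrite -card_gt0 cardsD (setIidPr sBA) subn_gt0 Bs.
by exists (x |: B); rewrite ?cardsU1 ?xB ?Bs // subUset sub1set xA.
Qed.

End Families.

Lemma subfamily_of_card (V : finType) (P : {set {set V}}) s :
  s <= #|P| -> exists2 B : {set {set V}}, B \subset P & #|B| = s.
Proof. exact: (@subset_of_card {set V}). Qed.

(** * Matchings *)

Section Matchings.
Variable V : finType.
Implicit Types (B M N : {set {set V}}) (A e : {set V}) (x y : V).

Definition is_pairs B := forall e, e \in B -> #|e| = 2.

Definition matching B M := (M \subset B) && trivIset M.

(** The matching number. *)
Definition nu B := \max_(M | matching B M) #|M|.

Definition maximum_matching B M := matching B M && (#|M| == nu B).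

Lemma matching0 B : matching B set0.
Proof.
by rewrite /matching sub0set; apply: trivIset_intro => A C x; rewrite inE.
Qed.

Lemma nu_max B M : matching B M -> #|M| <= nu B.
Proof. by move=> mM; apply: bigmax_sup mM _. Qed.

Lemma nu_ex B : exists M, maximum_matching B M.
Proof.
have ne : 0 < #|matching B| by apply/card_gt0P; exists set0; exact: matching0.
have [M mM eM] := eq_bigmax_cond (fun M => #|M|) ne.
by exists M; rewrite /maximum_matching /nu eM eqxx andbT.
Qed.

Lemma matching_add B M e : matching B M -> e \in B -> e != set0 ->
  [disjoint e & cover M] -> #|M| < nu B.
Proof.
move=> /andP[sM tM] Be /set0Pn[x xe] deM.
rewrite -(card_add xe deM) nu_max // /matching trivIset_add // andbT.
by rewrite subUset sub1set Be.
Qed.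

Lemma pair_of e x : #|e| = 2 -> x \in e ->
  exists y, x != y /\ e = [set x; y].
Proof.
move=> /eqP/cards2P[a [b [nab ->]]] /set2P[->|->]; first by exists b.
by exists a; rewrite eq_sym setUC.
Qed.

Definition adj B x y := [set x; y] \in B.

Lemma adjC B x y : adj B x y = adj B y x.
Proof. by rewrite /adj setUC. Qed.

Lemma adj_neq B x y : is_pairs B -> adj B x y -> x != y.
Proof. by move=> pB /pB; rewrite cards2; case: eqP. Qed.

Lemma maximum_adj B M x y : is_pairs B -> maximum_matching B M ->
  adj B x y -> x \notin cover M -> y \in cover M.
Proof.
move=> pB /andP[mM /eqP eM] Bxy xM; apply: contraT => yM.
suff : #|M| < nu B by rewrite eM ltnn.
apply: (matching_add mM Bxy); first by rewrite -card_gt0 (pB _ Bxy).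
rewrite -setI_eq0; apply/set0Pn => -[z /setIP[]].
by move=> /set2P[->|->]; [rewrite (negPf xM)|rewrite (negPf yM)].
Qed.

(** Gallai's exchange argument: if a maximum matching [M] misses [u] and [v],
choose, among the maximum matchings missing [w], the one [N] that shares most
edges with [M]. Both cover as many vertices, so [M] covers a vertex [x], other
than [w], that [N] misses; swapping for the edge of [M] at [x] the edge of [N]
that it touches brings [N] even closer to [M]. *)
Lemma jointly_covered_trans B u v w : is_pairs B ->
  (exists2 N, maximum_matching B N & w \notin cover N) ->
  (forall M, maximum_matching B M ->
     u \notin cover M -> w \notin cover M -> u = w) ->
  (forall M, maximum_matching B M ->
     w \notin cover M -> v \notin cover M -> w = v) ->
  forall M, maximum_matching B M ->
     u \notin cover M -> v \notin cover M -> u = v.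
Proof.
move=> pB [N0 mN0 wN0] uw wv M mM uM vM.
apply/eqP; case: (u =P v) => // /eqP nuv.
have wM : w \in cover M.
  apply: contraT => wM; move: nuv.
  by rewrite (uw _ mM uM wM) (wv _ mM wM vM) eqxx.
pose P N := maximum_matching B N && (w \notin cover N).
have P0 : P N0 by rewrite /P mN0 wN0.
case: (arg_maxnP (fun N => #|M :&: N|) P0) => N /andP[mN wN] Nmax.
have uN : u \in cover N.
  by apply: contraT => uN; move: uM; rewrite (uw _ mN uN wN) wM.
have vN : v \in cover N.
  by apply: contraT => vN; move: vM; rewrite -(wv _ mN wN vN) wM.
have pM L : maximum_matching B L -> forall e, e \in L -> #|e| = 2.
  by case/andP=> /andP[sL _] _ e /(subsetP sL)/pB.
have tL L : maximum_matching B L -> trivIset L by case/andP=> /andP[].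
have cc L : maximum_matching B L -> #|cover L| = nu B * 2.
  move=> mL; rewrite (card_cover_eq (tL _ mL) (pM _ mL)).
  by case/andP: mL => _ /eqP->.
(* [N] covers [u] and [v], which [M] misses; so [M] covers two vertices that
   [N] misses, and one of them is not [w]. *)
have cD : 1 < #|cover M :\: cover N|.
  have cMN : #|cover M :\: cover N| = #|cover N :\: cover M|.
    by apply/eqP; rewrite -(eqn_add2l #|cover M :&: cover N|) cardsID setIC cardsID !cc.
  rewrite cMN -(_ : #|[set u; v]| = 2); last by rewrite cards2 nuv.
  apply/subset_leq_card/subsetP => z /set2P[]->; rewrite inE.
    by rewrite uM.
  by rewrite vM.
have [x /setD1P[xw /setDP[xM xN]]] : exists x, x \in (cover M :\: cover N) :\ w.
  apply/set0Pn; rewrite -card_gt0; move: cD.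
  by rewrite (cardsD1 w); case: (w \in _) => // /ltnW.
have [e Me xe] := bigcupP xM.
have [y [nxy De]] := pair_of (pM _ mM _ Me) xe.
have Be : adj B x y.
  by rewrite /adj -De; case/andP: mM => /andP[/subsetP sM _] _; apply: sM.
have yN := maximum_adj pB mN Be xN.
have [g Ng yg] := bigcupP yN.
have ye : y \in e by rewrite De !inE eqxx orbT.
have gM : g \notin M.
  apply/negP => Mg; case/negP: xN; apply/bigcupP; exists g => //.
  by rewrite -(trivIset_eq (tL _ mM) Me Mg ye yg).
have deN : [disjoint e & cover (N :\ g)].
  rewrite -setI_eq0; apply/set0Pn => -[z /setIP[ze /bigcupP[f /setD1P[fg Nf] zf]]].
  move: ze; rewrite De => /set2P[] ez; subst z.
    by move: xN => /negP[]; apply/bigcupP; exists f.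
  by move: fg; rewrite (trivIset_eq (tL _ mN) Ng Nf yg zf) eqxx.
pose N' := e |: (N :\ g).
have cN' : #|N'| = #|N| by rewrite (card_add xe deN) (cardsD1 g N) Ng.
have tN' : trivIset N'.
  by apply: trivIset_add deN; apply: trivIsetS (tL _ mN); rewrite subsetDl.
have mN' : maximum_matching B N'.
  case/andP: (mN) => /andP[sN _] /eqP nN.
  rewrite /maximum_matching cN' nN eqxx andbT /matching tN' andbT.
  by rewrite subUset sub1set [e]De [_ \in B]Be (subset_trans (subsetDl _ _) sN).
have wN' : w \notin cover N'.
  apply/negP => /bigcupP[f /setU1P[->|/setD1P[_ Nf]] wf].
    move: wf; rewrite De => /set2P[ew|ew]; first by rewrite ew eqxx in xw.
    by rewrite ew yN in wN.
  by case/negP: wN; apply/bigcupP; exists f.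
have := Nmax N'; rewrite /P mN' wN' => /(_ isT).
rewrite /geq /= leqNgt => /negP[]; apply: proper_card; apply/properP; split.
  apply/subsetP => f /setIP[Mf Nf]; rewrite !inE Mf Nf /= andbT.
  by apply/orP; right; apply: contraNneq gM => <-.
exists e; first by rewrite !inE Me eqxx.
rewrite inE Me /=; apply: contra xN => Ne.
by apply/bigcupP; exists e.
Qed.

(** Gallai's lemma: no maximum matching misses both ends of an edge, and by
transitivity none misses two vertices of a component. *)
Lemma gallai B : is_pairs B ->
  (forall x, exists2 N, maximum_matching B N & x \notin cover N) ->
  forall x y, connect (adj B) x y -> forall M, maximum_matching B M ->
    x \notin cover M -> y \notin cover M -> x = y.
Proof.
move=> pB miss x y /connectP[s]; elim/last_ind: s y => [|s z IH] y /=.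
  by move=> _ ->.
rewrite rcons_path last_rcons => /andP[ps azz] -> M mM.
apply: (jointly_covered_trans pB (miss (last x s))) mM => [N|N] mN xN.
  exact: (IH (last x s) ps erefl N mN xN).
by rewrite (maximum_adj pB mN azz xN).
Qed.

Definition outside B A := [set e in B | [disjoint e & A]].

(** The nontrivial half of the Tutte-Berge formula. Take [A] as large as possible
with [#|A| + nu (outside B A) <= nu B]. If a vertex were covered by all the
maximum matchings off [A], it could join [A]; so Gallai's lemma applies off
[A]. *)
Lemma tutte_berge B : is_pairs B ->
  exists A M, [/\ maximum_matching (outside B A) M, #|A| + #|M| <= nu B &
    forall x y, connect (adj (outside B A)) x y ->
      x \notin cover M -> y \notin cover M -> x = y].
Proof.
move=> pB; pose P A := #|A| + nu (outside B A) <= nu B.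
have P0 : P set0.
  rewrite /P cards0; apply/bigmax_leqP => M /andP[sM tM].
  apply: nu_max; rewrite /matching tM andbT; apply: subset_trans sM _.
  by apply/subsetP => e; rewrite inE => /andP[].
case: (arg_maxnP (fun A : {set V} => #|A|) P0) => A PA Amax.
have pR : is_pairs (outside B A) by move=> e; rewrite inE => /andP[/pB].
have miss x : exists2 N, maximum_matching (outside B A) N & x \notin cover N.
  have [xA|xA] := boolP (x \in A).
    have [N mN] := nu_ex (outside B A); exists N => //.
    apply/negP => /bigcupP[e Ne xe]; case/andP: mN => /andP[/subsetP/(_ _ Ne)].
    by rewrite inE => /andP[_ /disjointFr/(_ xe)]; rewrite xA.
  case: (pickP (fun N => maximum_matching (outside B A) N && (x \notin cover N))).
    by move=> N /andP[mN xN]; exists N.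
  move=> none; suff : P (x |: A).
    by move=> /Amax; rewrite /geq /= cardsU1 xA ltnn.
  rewrite /P cardsU1 xA add1n addSn; apply: leq_trans PA.
  rewrite -addnS leq_add2l; have [N mN] := nu_ex (outside B (x |: A)).
  case/andP: mN => /andP[sN tN] /eqP <-.
  have xN : x \notin cover N.
    apply/negP => /bigcupP[e /(subsetP sN)]; rewrite inE => /andP[_ dA] xe.
    by have := disjointFr dA xe; rewrite !inE eqxx.
  have mN : matching (outside B A) N.
    rewrite /matching tN andbT; apply: subset_trans sN _.
    apply/subsetP => e; rewrite !inE => /andP[-> /=].
    by apply: disjointWr; rewrite subsetUr.
  rewrite ltn_neqAle (nu_max mN) andbT; apply/negP => eN.
  by have := none N; rewrite /= /maximum_matching mN eN xN.
have [M mM] := nu_ex (outside B A); exists A, M; split=> //.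
  by case/andP: mM => _ /eqP ->.
by move=> x y cxy; apply: gallai cxy M mM.
Qed.

End Matchings.

(** * Edge counts from matching numbers *)

Section Degrees.
Variable V : finType.
Implicit Types (B M N : {set {set V}}) (A e : {set V}) (x y v : V).

Definition nbr B v := [set u | adj B v u].

Definition deg B v := #|[set e in B | v \in e]|.

Lemma deg_nbr B v : is_pairs B -> deg B v = #|nbr B v|.
Proof.
move=> pB; rewrite /deg -(card_in_imset (f := fun u => [set v; u])) => [|x y].
  apply/eq_card => e; apply/idP/imsetP.
    rewrite inE => /andP[Be ve]; have [y [_ De]] := pair_of (pB _ Be) ve.
    by exists y; rewrite // inE /adj -De.
  by case=> u; rewrite !inE => vu ->; rewrite [_ \in B]vu !inE eqxx.
rewrite !inE => /(adj_neq pB) nvx /(adj_neq pB) nvy /setP/(_ x).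
by rewrite !inE eqxx orbT => /esym/orP[/eqP exv|/eqP//]; rewrite exv eqxx in nvx.
Qed.

Lemma sum_mem_card (T : finType) (A C : {set T}) :
  \sum_(x in A) (x \in C) = #|A :&: C|.
Proof.
rewrite -sum1_card big_mkcond [RHS]big_mkcond /=; apply: eq_bigr => x _.
by rewrite inE; case: (x \in A); case: (x \in C).
Qed.

Lemma handshake B : is_pairs B -> \sum_v deg B v = 2 * #|B|.
Proof.
move=> pB; rewrite mulnC -sum_nat_const.
have dE v : deg B v = \sum_(e in B) (v \in e).
  rewrite /deg -sum1_card big_mkcond [RHS]big_mkcond /=.
  by apply: eq_bigr => e _; rewrite inE; case: (e \in B); case: (v \in e).
rewrite (eq_bigr _ (fun v _ => dE v)) exchange_big /=.
apply: eq_bigr => e /pB <-.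
rewrite -sum1_card [RHS]big_mkcond; apply: eq_bigr => v _.
by case: (v \in e).
Qed.

(** The edges at the set [A] of the Tutte-Berge formula are counted by the degrees
of [A]: each vertex of [A] costs one edge of a maximum matching, and its double
degree is at most [D + delta + m v]. The other edges are counted by components:
one that contains [s] edges of the matching has at most [2 * s + 1] vertices, so
its degrees are at most [2 * s]. The weights [m] pay for the degrees above
[delta]; they are counted once only, although a degree counts twice on [A]. *)
Lemma weighted_edge_bound B (m : V -> nat) D delta w : is_pairs B ->
  (forall v, deg B v <= D) -> (forall v, deg B v <= delta + m v) ->
  D + delta <= w ->
  (forall s, (2 * s + 1) * minn (2 * s) delta <= s * w) ->
  2 * #|B| <= nu B * w + \sum_v m v.
Proof.
move=> pB dD dm wD ws; have [A [M [mM AM uq]]] := tutte_berge pB.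
set R := outside B A in mM uq.
have pR : is_pairs R by move=> e; rewrite inE => /andP[/pB].
have cs : connect_sym (adj R) by apply: sym_connect_sym => x y; exact: adjC.
pose C z := [set v | root (adj R) v == z].
pose s z := #|[set e in M | e \subset C z]|.
have sM : {subset M <= R} by case/andP: mM => /andP[/subsetP].
have edgeC e x : e \in R -> x \in e -> e \subset C (root (adj R) x).
  move=> Re xe; have [y [_ De]] := pair_of (pR _ Re) xe.
  rewrite De subUset !sub1set !inE eqxx /= (root_connect cs) cs.
  by apply: connect1; rewrite /adj -De.
have CS z : #|C z| <= 2 * s z + 1.
  rewrite -(cardsID (cover M)) leq_add //.
    rewrite mulnC; apply: leq_trans (card_cover_le (s := 2) _); last first.
      by move=> e; rewrite inE => /andP[/sM/pR->].
    apply/subset_leq_card/subsetP => x /setIP[]; rewrite inE => /eqP <-.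
    case/bigcupP=> e Me xe; apply/bigcupP; exists e => //.
    by rewrite inE Me edgeC // sM.
  apply/card_le1_eqP => x y; rewrite !inE => /andP[xM /eqP ex] /andP[yM ey].
  by apply: uq => //; rewrite -(root_connect cs) ex.
have degR v : deg R v <= minn (2 * s (root (adj R) v)) delta + m v.
  have le1 : deg R v <= 2 * s (root (adj R) v).
    rewrite deg_nbr // -ltnS -[(2 * _).+1]addn1; apply: leq_trans (CS _).
    have vC : v \in C (root (adj R) v) by rewrite inE.
    rewrite [X in _ < X](cardsD1 v) vC add1n ltnS; apply/subset_leq_card/subsetP => u.
    rewrite inE => Rvu; rewrite !inE eq_sym (adj_neq pR Rvu) /=.
    by rewrite (root_connect cs) cs connect1.
  have le2 : deg R v <= delta + m v.
    apply: leq_trans (dm v); apply/subset_leq_card/subsetP => e.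
    by rewrite !inE => /andP[/andP[-> _] ->].
  by rewrite /minn; case: ltnP => _; lia.
have degR0 v : v \in A -> deg R v = 0.
  move=> vA; apply/eqP; rewrite cards_eq0; apply/eqP/setP => e; rewrite !inE.
  by apply/negP => /andP[/andP[_ dA] ve]; have := disjointFr dA ve; rewrite vA.
have cB : #|B| <= \sum_(v in A) deg B v + #|R|.
  rewrite -(cardsID R) addnC leq_add //; last first.
    by apply/subset_leq_card/subsetP => e /setIP[].
  have -> : B :\: R = \bigcup_(v in A) [set e in B | v \in e].
    apply/setP => e; rewrite !inE; apply/andP/bigcupP.
      case=> + Be; rewrite Be /= -setI_eq0 => /set0Pn[v /setIP[ve vA]].
      by exists v; rewrite // inE Be.
    case=> v vA; rewrite inE => /andP[Be ve]; split=> //.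
    by rewrite Be /=; apply/negP => dA; have := disjointFr dA ve; rewrite vA.
  apply: (big_ind2 (fun (X : {set {set V}}) n => #|X| <= n)) => //.
    by rewrite cards0.
  move=> X n1 Y n2 h1 h2; have [le12 _] := leq_card_setU X Y.
  exact: leq_trans le12 (leq_add h1 h2).
have sR : \sum_v deg R v <= #|M| * w + \sum_(v | v \notin A) m v.
  rewrite (bigID (mem A)) /= big1 ?add0n => [|v /degR0 //].
  apply: (@leq_trans (\sum_(v | v \notin A)
                        (minn (2 * s (root (adj R) v)) delta + m v))).
    by apply: leq_sum => v _; exact: degR.
  rewrite big_split /= leq_add2r.
  apply: (@leq_trans (\sum_v minn (2 * s (root (adj R) v)) delta)).
    by rewrite [leqRHS](bigID (mem A)) /= leq_addl.
  rewrite (partition_big (root (adj R)) predT) //=.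
  apply: (@leq_trans (\sum_z s z * w)).
    apply: leq_sum => z _; apply: leq_trans (ws _).
    rewrite (eq_bigr (fun _ => minn (2 * s z) delta)) => [|v /eqP-> //].
    rewrite sum_nat_const leq_mul2r; apply/orP; right.
    by apply: leq_trans (CS z); rewrite cardsE.
  rewrite -big_distrl /= leq_mul2r; apply/orP; right.
  rewrite /s (eq_bigr (fun z => \sum_(e in M) (e \subset C z))); last first.
    move=> z _; rewrite -sum1_card big_mkcond [RHS]big_mkcond /=.
    by apply: eq_bigr => e _; rewrite inE; case: (e \in M); case: (_ \subset _).
  rewrite exchange_big -sum1_card /=; apply: leq_sum => e Me.
  have /card_gt0P[x xe] : 0 < #|e| by rewrite (pR _ (sM _ Me)).
  rewrite (bigD1 (root (adj R) x)) //= big1 ?addn0 ?leq_b1 // => z nz.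
  apply/eqP; rewrite eqb0; apply: contra nz => /subsetP/(_ _ xe).
  by rewrite inE eq_sym.
have sA : 2 * (\sum_(v in A) deg B v) <= #|A| * w + \sum_(v in A) m v.
  rewrite big_distrr /= -sum_nat_const -big_split /=; apply: leq_sum => v _.
  by have := dD v; have := dm v; lia.
have -> : \sum_v m v = \sum_(v in A) m v + \sum_(v | v \notin A) m v.
  by rewrite (bigID (mem A)).
have := handshake pR.
have : #|A| * w + #|M| * w <= nu B * w by rewrite -mulnDl leq_mul2r AM orbT.
by lia.
Qed.

(** The same bound follows from Vizing's theorem, a proper edge colouring having
at most [D.+1] classes. *)
Lemma edge_bound B D : is_pairs B -> (forall v, deg B v <= D) ->
  #|B| <= nu B * D.+1.
Proof.
move=> pB dD; have H s : (2 * s + 1) * minn (2 * s) D <= s * (2 * D.+1).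
  by rewrite /minn; case: ltnP => h; nia.
have := weighted_edge_bound (m := fun=> 0) pB dD _ _ H.
have dm v : deg B v <= D + 0 by rewrite addn0.
have DD : D + D <= 2 * D.+1 by lia.
by move=> /(_ dm DD); rewrite big1 // addn0; lia.
Qed.

End Degrees.

(** * Fans as families of disjoint cliques *)

Section Fans.
Variable V : finType.
Implicit Types (E Q Ts : {set {set V}}) (A X K T W : {set V}) (v x y : V).

Definition pairs_in W := [set e : {set V} | (#|e| == 2) && (e \subset W)].

Lemma card_all_pairs (W : {set V}) : 2 * #|pairs_in W| = #|W| * #|W|.-1.
Proof.
have pP : is_pairs (pairs_in W) by move=> e; rewrite inE => /andP[/eqP].
rewrite -handshake // -sum_nat_const [RHS]big_mkcond; apply: eq_bigr => v _.
rewrite deg_nbr //; case: (boolP (v \in W)) => vW.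
  rewrite (cardsD1 v W) vW add1n /=; apply: eq_card => u.
  rewrite in_setD1 [u == v]eq_sym in_set /adj in_set cards2 subUset !sub1set vW.
  by case: (v == u).
apply/eqP; rewrite cards_eq0; apply/eqP/setP => u.
by rewrite in_set /adj in_set subUset !sub1set (negPf vW) andbF in_set0.
Qed.

Definition clique_in E K :=
  forall x y, x \in K -> y \in K -> x != y -> adj E x y.

(** The cliques of a fan are given by their [q] vertices besides the centre [v];
this makes a fan a set of disjoint sets rather than an embedding. *)
Definition fan_at E q v Q := trivIset Q /\
  forall K, K \in Q -> [/\ #|K| = q, v \notin K & clique_in E (v |: K)].

Definition fan_free E q k := forall v Q, fan_at E q v Q -> #|Q| < k.

Lemma clique_inS E E' K : E \subset E' -> clique_in E K -> clique_in E' K.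
Proof. by move=> /subsetP sE cK x y xK yK nxy; apply/sE/cK. Qed.

Lemma clique_in_sub E K K' : K' \subset K -> clique_in E K -> clique_in E K'.
Proof. by move=> /subsetP sK cK x y xK yK; apply: cK; apply: sK. Qed.

Lemma fan_atS E E' q v Q : E \subset E' -> fan_at E q v Q -> fan_at E' q v Q.
Proof.
move=> sE [tQ fQ]; split=> // K /fQ[? ? cK]; split=> //.
exact: clique_inS cK.
Qed.

Lemma fan_freeS E E' q k : E \subset E' -> fan_free E' q k -> fan_free E q k.
Proof. by move=> sE fE v Q /(fan_atS sE)/fE. Qed.

Definition petal (k r : nat) (i : 'I_k) : {set option ('I_k * 'I_r.-1)} :=
  [set Some (i, j) | j : 'I_r.-1].

Lemma fan_of_copy k r E (f : {ffun option ('I_k * 'I_r.-1) -> V}) : 1 < r ->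
  injective f -> copy_edges (fan k r) f \subset E ->
  exists v Q, fan_at E r.-1 v Q /\ #|Q| = k.
Proof.
move=> r1 f_inj sE; pose Q := [set f @: petal r i | i : 'I_k].
have dis (i i' : 'I_k) x : x \in f @: petal r i -> x \in f @: petal r i' -> i = i'.
  by case/imsetP=> _ /imsetP[j _ ->] -> /imsetP[_ /imsetP[j' _ ->] /f_inj[]].
exists (f None), Q; split; last first.
  rewrite card_imset ?card_ord // => i i' eii.
  have j0 : 'I_r.-1 by case: r r1 {f f_inj sE Q dis eii} => [|[|r]] // _; exact: ord0.
  have xi : f (Some (i, j0)) \in f @: petal r i by rewrite !imset_f.
  by apply: dis (xi) _; rewrite -eii.
split.
  apply: trivIset_intro => _ _ x /imsetP[i _ ->] /imsetP[i' _ ->] xi xi'.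
  by rewrite (dis _ _ _ xi xi').
move=> _ /imsetP[i _ ->]; split.
- rewrite !card_imset ?card_ord // => j j'; by case.
- by apply/imsetP => -[_ /imsetP[j _ ->] /f_inj].
move=> x y; rewrite -imsetU1 => /imsetP[a ai ->] /imsetP[b bi ->] nab.
apply: (subsetP sE); apply/imsetP; exists [set a; b]; last first.
  by rewrite imsetU1 imset_set1.
rewrite inE cards2 (contra_neq _ nab) => [|-> //] /=.
by apply/existsP; exists i; rewrite subUset !sub1set ai bi.
Qed.

Lemma copy_of_fan k r E v Q : fan_at E r.-1 v Q -> k <= #|Q| ->
  exists f : {ffun option ('I_k * 'I_r.-1) -> V},
    injective f /\ copy_edges (fan k r) f \subset E.
Proof.
move=> [tQ fQ] kQ; pose K (i : nat) := nth set0 (enum Q) i.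
have KQ (i : 'I_k) : K i \in Q.
  by rewrite -mem_enum mem_nth // -cardE (leq_trans _ kQ).
pose g (i : 'I_k) (j : 'I_r.-1) := nth v (enum (K i)) j.
have sK (i : 'I_k) (j : 'I_r.-1) : j < size (enum (K i)).
  by rewrite -cardE; case: (fQ _ (KQ i)) => ->.
have gK i j : g i j \in K i by rewrite -mem_enum mem_nth.
pose h (a : option ('I_k * 'I_r.-1)) := if a is Some ij then g ij.1 ij.2 else v.
pose f : {ffun option ('I_k * 'I_r.-1) -> V} := finfun h.
have vg i j : v <> g i j.
  by move=> vij; case: (fQ _ (KQ i)) => _ /negP[]; rewrite vij.
have f_inj : injective f.
  case=> [[i j]|] [[i' j']|] //; rewrite !ffunE //=; last 2 first.
  - by move/esym/vg.
  - by move/vg.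
  move=> eg; have /eqP : K i = K i'.
    by apply: (trivIset_eq tQ (KQ i) (KQ i') (gK i j)); rewrite eg.
  rewrite nth_uniq ?enum_uniq -?cardE ?(leq_trans _ kQ) // => /eqP/val_inj ei.
  move: eg; rewrite -ei => /eqP; rewrite nth_uniq ?enum_uniq ?sK //.
  by move=> /eqP/val_inj ->.
exists f; split=> //; apply/subsetP => _ /imsetP[e] /[swap] ->.
rewrite inE => /andP[/cards2P[a [b [nab ->]]] /existsP[i]].
rewrite subUset !sub1set => /andP[ai bi]; rewrite imsetU1 imset_set1.
case: (fQ _ (KQ i)) => _ _ cl.
have inK c : c \in clique r i -> f c \in v |: K i.
  rewrite ffunE => /setU1P[->|/imsetP[j _ ->]]; first by rewrite setU11.
  by rewrite setU1r // gK.
by apply: cl; rewrite ?inK //; apply: contra_neq nab => /f_inj.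
Qed.

End Fans.

Lemma contains_fanP n k r (H : sgraph 'I_n) : 1 < r ->
  reflect (exists v Q, fan_at H r.-1 v Q /\ k <= #|Q|) (contains H (fan k r)).
Proof.
move=> r1; apply: (iffP existsP).
  case=> f /andP[/injectiveP f_inj sE].
  have [v [Q [fQ cQ]]] := fan_of_copy r1 f_inj sE.
  by exists v, Q; rewrite cQ.
case=> v [Q [fQ kQ]]; have [f [f_inj sE]] := copy_of_fan fQ kQ.
by exists f; rewrite /is_copy sE andbT; apply/injectiveP.
Qed.

Lemma fan_free_contains n k r (H : sgraph 'I_n) : 1 < r ->
  fan_free H r.-1 k -> ~~ contains H (fan k r).
Proof.
move=> r1 fH; apply/negP => /contains_fanP-/(_ r1)[v [Q [/fH]]].
by rewrite ltnNge => /negPf->.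
Qed.

(** A rainbow copy is a copy inside some set of edges on which the colouring is
injective; this reduces all the arguments on colourings to graphs. *)
Lemma rainbowP n m (c : {ffun {set 'I_n} -> 'I_m}) k r : 1 < r ->
  reflect (exists E, [/\ is_pairs E, {in E &, injective c} &
             exists v Q, fan_at E r.-1 v Q /\ k <= #|Q|])
          (has_rainbow c (fan k r)).
Proof.
move=> r1; apply: (iffP existsP).
  case=> f /andP[/andP[/injectiveP f_inj sE] /dinjectiveP cE].
  exists (copy_edges (fan k r) f); split=> //.
    by move=> e /(subsetP sE); rewrite inE => /eqP.
  have [v [Q [fQ cQ]]] := fan_of_copy r1 f_inj (subxx _).
  by exists v, Q; rewrite cQ.
case=> E [pE cE [v [Q [fQ kQ]]]]; have [f [f_inj sE]] := copy_of_fan fQ kQ.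
exists f; rewrite /is_copy; apply/andP; split; last first.
  by apply/dinjectiveP => e e' /(subsetP sE) Ee /(subsetP sE); apply: cE.
apply/andP; split; first exact/injectiveP.
by apply: subset_trans sE _; apply/subsetP => e /pE; rewrite inE => ->.
Qed.

(** * Seeds of the cliques of a fan *)

Lemma card_bigcup_le (T V : finType) (A : {set T}) (F : T -> {set V}) c :
  (forall t, t \in A -> #|F t| <= c) -> #|\bigcup_(t in A) F t| <= #|A| * c.
Proof.
move=> ub; rewrite -sum_nat_const.
apply: (big_ind2 (fun (X : {set V}) n => #|X| <= n)) => //.
  by rewrite cards0.
move=> X n1 Y n2 h1 h2; have [le12 _] := leq_card_setU X Y.
exact: leq_trans le12 (leq_add h1 h2).
Qed.

Lemma card_setU_le (V : finType) (A B : {set V}) : #|A :|: B| <= #|A| + #|B|.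
Proof. by case: (leq_card_setU A B). Qed.

Section Seeds.
Variables (V : finType) (q : nat) (p : V -> 'I_q).
Implicit Types (E Q Ts : {set {set V}}) (X K T W : {set V}) (v x y : V).

(** Among the [q + 1] vertices of a clique of a fan centred at [v], two are in the
same one of the [q] parts: another vertex in the part of [v], or two vertices of
another part. Conversely, if almost all the pairs between distinct parts are
edges, disjoint seeds are completed to a fan by transversals of the other
parts. *)
Definition seed E v T := clique_in E (v |: T) /\
  ((exists u, [/\ T = [set u], u != v & p u = p v]) \/
   (exists a b, [/\ T = [set a; b], a != b, p a = p b & p a != p v])).

Definition seeds_at E v Ts := trivIset Ts /\ forall T, T \in Ts -> seed E v T.

Lemma seeds_at_sub E v Ts Ts' : Ts' \subset Ts -> seeds_at E v Ts ->
  seeds_at E v Ts'.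
Proof.
move=> sT [tT sd]; split; first exact: trivIsetS tT.
by move=> T /(subsetP sT)/sd.
Qed.

Lemma fan_seeds E v Q : fan_at E q v Q ->
  exists Ts, seeds_at E v Ts /\ #|Ts| = #|Q|.
Proof.
move=> [tQ fQ].
have /fin_all_exists[g gP] (K : {set V}) : exists T, K \in Q ->
    [/\ T \subset K, exists x, x \in T & seed E v T].
  case: (boolP (K \in Q)) => [KQ|_]; last by exists K.
  have [cK vK cl] := fQ _ KQ.
  have [u /andP[uK /eqP pu]|none] := pickP [pred u | (u \in K) && (p u == p v)].
    exists [set u] => _; split.
    - by rewrite sub1set.
    - by exists u; rewrite set11.
    split; first by apply: clique_in_sub cl; rewrite setUS // sub1set.
    by left; exists u; split=> //; apply: contraNneq vK => <-.
  have : ~~ dinjectiveb p (mem K).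
    apply/negP => /dinjectiveP p_inj.
    have := card_in_imset p_inj; rewrite cK => cpK.
    have : #|p @: K| < q.
      rewrite -[X in _ < X]card_ord -cardsT; apply: proper_card.
      apply/properP; split; first exact: subsetT.
      exists (p v); rewrite ?inE //; apply/imsetP => -[u uK pu].
      by have := none u; rewrite /= uK pu eqxx.
    by rewrite cpK ltnn.
  case/dinjectivePn => a aK [b]; rewrite inE => /andP[nba bK] pab.
  exists [set a; b] => _; split.
  - by rewrite subUset !sub1set; apply/andP.
  - by exists a; rewrite !inE eqxx.
  split.
    by apply: clique_in_sub cl; rewrite setUS // subUset !sub1set; apply/andP.
  right; exists a, b; split=> //; first by rewrite eq_sym.
  by apply/eqP => pa; have := none a; rewrite /= pa eqxx andbT => /negP[].
have [tg cg] := trivIset_shrink tQ (fun K KQ => let: And3 h _ _ := gP K KQ in h)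
                  (fun K KQ => let: And3 _ h _ := gP K KQ in h).
exists (g @: Q); split=> //; split=> // _ /imsetP[K KQ ->].
by have [] := gP K KQ.
Qed.

Lemma seed_ne E v T : seed E v T -> exists x, x \in T.
Proof.
case=> _ [[u [-> _ _]]|[a [b [-> _ _ _]]]]; first by exists u; rewrite set11.
by exists a; rewrite !inE eqxx.
Qed.

Lemma seed_notin E v T : seed E v T -> v \notin T.
Proof.
case=> _ [[u [-> nu _]]|[a [b [-> _ pab pav]]]]; first by rewrite inE eq_sym.
rewrite !inE; apply/negP => /orP[]/eqP ev; move: pav; rewrite ev ?eqxx //.
by rewrite pab eqxx.
Qed.

Lemma seed_card_le E v T : seed E v T -> #|T| <= 2.
Proof.
case=> _ [[u [-> _ _]]|[a [b [-> _ pab pav]]]]; first by rewrite cards1.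
by rewrite cards2; case: eqP.
Qed.

(** So the number of parts that the seed and its centre leave free is the number
of vertices missing in the clique. *)
Lemma seed_parts E v T : seed E v T -> #|p @: (v |: T)| = #|T|.
Proof.
case=> _ [[u [-> nu pu]]|[a [b [-> nab pab pav]]]].
  by rewrite imsetU1 imset_set1 pu setUid !cards1.
by rewrite !imsetU1 imset_set1 pab setUid !cards2 nab -pab eq_sym pav.
Qed.

Lemma seed_center E W v T : E \subset pairs_in W -> seed E v T ->
  v |: T \subset W.
Proof.
move=> sE sd; have [x xT] := seed_ne sd; have vT := seed_notin sd.
have EW y z : adj E y z -> (y \in W) && (z \in W).
  by move=> /(subsetP sE); rewrite inE subUset !sub1set => /andP[].
case: sd => cl _; apply/subsetP => y /setU1P[->|yT].
  have nvx : v != x by apply: contraNneq vT => ->.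
  by have /EW/andP[] := cl v x (setU11 _ _) (setU1r _ xT) nvx.
have nvy : v != y by apply: contraNneq vT => ->.
by have /EW/andP[] := cl v y (setU11 _ _) (setU1r _ yT) nvy.
Qed.

(** Greedy choice, one vertex in each part [i] of [J] within the pool [A i]: each
of the vertices chosen before excludes at most [c] vertices of the pool. *)
Lemma transversal E (A : 'I_q -> {set V}) c (J : {set 'I_q}) T :
  is_pairs E -> clique_in E T ->
  (forall t i, t \in T -> i \in J -> #|[set u in A i | ~~ adj E t u]| <= c) ->
  (forall i j x, i \in J -> j \in J -> i != j -> x \in A i ->
     #|[set u in A j | ~~ adj E x u]| <= c) ->
  (forall i, i \in J -> (#|T| + #|J|) * c < #|A i|) ->
  exists Y : {set V}, [/\ #|Y| = #|J|, forall y, y \in Y -> exists2 i, i \in J & y \in A i,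
                [disjoint Y & T] & clique_in E (T :|: Y)].
Proof.
move=> pE; have [n] := ubnP #|J|; elim: n J T => // n IH J T Jn clT mT mA big.
have [J0|[i Ji]] := set_0Vmem J.
  exists set0; rewrite J0 !cards0 setU0 -setI_eq0 set0I eqxx; split=> // y.
  by rewrite inE.
pose bad := \bigcup_(t in T) [set u in A i | ~~ adj E t u].
have cbad : #|bad| <= #|T| * c by apply: card_bigcup_le => t tT; apply: mT.
have [x /setDP[xA xbad]] : exists x, x \in A i :\: bad.
  apply/set0Pn; rewrite -card_gt0; have := cardsID bad (A i).
  have := subset_leq_card (subsetIr (A i) bad); have := big i Ji.
  by rewrite mulnDl; lia.
have adjT t : t \in T -> adj E t x.
  move=> tT; apply: contraNT xbad => ntx.
  by apply/bigcupP; exists t; rewrite // inE xA.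
have [] := IH (J :\ i) (x |: T).
- by move: Jn; rewrite (cardsD1 i J) Ji.
- move=> y z /setU1P[->|yT] /setU1P[->|zT] nyz.
  + by rewrite eqxx in nyz.
  + by rewrite adjC adjT.
  + exact: adjT.
  + exact: clT.
- move=> t j /setU1P[->|tT] /setD1P[nji Jj]; last exact: mT.
  by apply: (mA i) => //; rewrite eq_sym.
- by move=> j k y /setD1P[_ Jj] /setD1P[_ Jk]; apply: mA.
- move=> j /setD1P[_ Jj]; apply: leq_ltn_trans (big j Jj).
  rewrite leq_mul2r; apply/orP; right.
  rewrite (cardsD1 i J) Ji addnA leq_add2r addn1 cardsU1.
  by case: (_ \notin _); rewrite ?add1n ?add0n.
move=> Y [cY sY dY clY]; exists (x |: Y).
have xY : x \notin Y.
  by apply/negP => xY; have := disjointFr dY xY; rewrite setU11.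
split.
- by rewrite cardsU1 xY cY (cardsD1 i J) Ji.
- by move=> y /setU1P[->|/sY[j /setD1P[_ Jj] yj]]; [exists i|exists j].
- rewrite disjoint_sym -setI_eq0; apply/set0Pn => -[y /setIP[yT /setU1P[eyx|yY]]].
    by have := adj_neq pE (adjT _ yT); rewrite eyx eqxx.
  by have := disjointFr dY yY; rewrite !inE yT orbT.
by rewrite setUCA setUA.
Qed.

Definition part W (i : 'I_q) := [set u in W | p u == i].

Definition crossmiss E W v := [set u in W | (p u != p v) && ~~ adj E v u].

(** The seeds are completed one after the other, each time off [X], the vertices of
the other seeds and of the cliques built so far. *)
Lemma seeds_fan E W c k v Ts : E \subset pairs_in W ->
  (forall x, x \in W -> #|crossmiss E W x| <= c) ->
  (forall i, (q + 1) * c + (k * (q + 2) + 1) < #|part W i|) ->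
  seeds_at E v Ts -> #|Ts| <= k ->
  exists Q, fan_at E q v Q /\ #|Q| = #|Ts|.
Proof.
move=> sE mE big [tT sd] cT.
have pE : is_pairs E by move=> e /(subsetP sE); rewrite inE => /andP[/eqP].
suff step (n : nat) : n <= #|Ts| -> exists Ts' Q, [/\ Ts' \subset Ts, #|Ts'| = n,
    fan_at E q v Q, #|Q| = n & [disjoint cover Q & cover (Ts :\: Ts')]].
  by have [Ts' [Q [_ _ fQ cQ _]]] := step _ (leqnn _); exists Q.
elim: n => [|n IH] nT.
  exists set0, set0; rewrite sub0set cards0; split=> //.
    split=> [|K]; last by rewrite inE.
    by apply: trivIset_intro => A B x; rewrite inE.
  by rewrite /cover big_set0 -setI_eq0 set0I.
have [Ts' [Q [sT' cT' [tQ fQ] cQ dQ]]] := IH (ltnW nT).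
have [T /setDP[TT TT']] : exists T, T \in Ts :\: Ts'.
  by apply/set0Pn; rewrite -card_gt0 cardsD (setIidPr sT') cT' subn_gt0.
have sdT := sd _ TT; have [x0 x0T] := seed_ne sdT.
pose X := v |: (cover Ts :|: cover Q).
have cX : #|X| <= 1 + (k * 2 + k * q).
  rewrite cardsU1 leq_add ?leq_b1 //; apply: leq_trans (card_setU_le _ _) _.
  apply: leq_add.
    apply: leq_trans (card_cover_le (s := 2) _) _; last by rewrite leq_mul2r cT orbT.
    by move=> S /sd/seed_card_le.
  apply: leq_trans (card_cover_le (s := q) _) _.
    by move=> S /fQ[->].
  by rewrite leq_mul2r cQ (leq_trans (ltnW nT) cT) orbT.
pose J := ~: (p @: (v |: T)).
have cJ : #|J| = q - #|T|.
  by rewrite /J cardsCs setCK (seed_parts sdT) card_ord.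
have cTq : #|T| <= q.
  by rewrite -(seed_parts sdT) -[X in _ <= X]card_ord max_card.
have cvT : #|v |: T| = #|T|.+1 by rewrite cardsU1 (seed_notin sdT).
have miss x j : x \in W -> p x != j ->
    #|[set u in part W j :\: X | ~~ adj E x u]| <= c.
  move=> xW nj; apply: leq_trans (mE _ xW).
  apply/subset_leq_card/subsetP => u; rewrite !inE.
  move=> /andP[/andP[_ /andP[-> /eqP->]] ->]; by rewrite eq_sym nj.
have := @transversal E (fun i => part W i :\: X) c J (v |: T) pE.
case.
- by case: sdT.
- move=> t i tvT; rewrite inE => nti; apply: miss.
    exact: subsetP (seed_center sE sdT) _ tvT.
  by apply: contraNneq nti => <-; apply: imset_f.
- move=> i j x _ _ nij; rewrite !inE => /andP[_ /andP[xW /eqP xi]].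
  by apply: miss; rewrite ?xi.
- move=> i _; have -> : #|v |: T| + #|J| = q + 1 by rewrite cvT cJ addSn subnKC // addn1.
  have := cardsID X (part W i); have := big i.
  have := subset_leq_card (subsetIr (part W i) X); lia.
move=> Y [cY sY dY clY].
have YX y : y \in Y -> y \notin X.
  by move=> /sY[i _]; rewrite inE => /andP[].
pose K := T :|: Y.
have x0K : x0 \in K by rewrite inE x0T.
have dK : [disjoint K & cover Q].
  rewrite -setI_eq0; apply/set0Pn => -[x /setIP[/setUP[xT|xY] xQ]].
    have := disjointFr dQ xQ; have -> // : x \in cover (Ts :\: Ts').
    by apply/bigcupP; exists T; rewrite // inE TT TT'.
  by have := YX _ xY; rewrite !inE xQ !orbT.
have T'T : T |: Ts' \subset Ts by rewrite subUset sub1set TT sT'.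
exists (T |: Ts'), (K |: Q); split=> //.
- by rewrite cardsU1 TT' cT'.
- split; first exact: trivIset_add.
  move=> L /setU1P[->|/fQ //]; split.
  + rewrite cardsU (_ : T :&: Y = set0) ?cards0 ?subn0 ?cY ?cJ ?subnKC //.
    apply/eqP; rewrite setIC setI_eq0; apply: disjointWr dY.
    by rewrite subsetUr.
  + rewrite inE negb_or (seed_notin sdT) /=; apply/negP => /YX.
    by rewrite setU11.
  by rewrite setUA.
- by rewrite (card_add x0K dK) cQ.
rewrite -setI_eq0; apply/set0Pn => -[x /setIP[/bigcupP[L LKQ xL]]].
case/bigcupP=> S; rewrite !inE negb_or => /andP[/andP[nST nST'] TS] xS.
case/setU1P: LKQ => [eL|LQ].
  move: xL; rewrite eL => /setUP[xT|/YX].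
    by move: nST; rewrite (trivIset_eq tT TS TT xS xT) eqxx.
  by case/negP; rewrite !inE; apply/orP; right; apply/orP; left; apply/bigcupP; exists S.
have xQ : x \in cover Q by apply/bigcupP; exists L.
have := disjointFr dQ xQ; have -> // : x \in cover (Ts :\: Ts').
by apply/bigcupP; exists S; rewrite // inE nST'.
Qed.

End Seeds.

(** * The partition of a dense graph without fans *)

Section Structure.
Variable V : finType.
Implicit Types (E Q Ts : {set {set V}}) (X K T W : {set V}) (v x y z : V).

Lemma clique_inP E K :
  reflect (clique_in E K)
    [forall x in K, forall y in K, (x != y) ==> adj E x y].
Proof.
apply: (iffP forall_inP) => [cl x y /cl/forall_inP h /h/implyP//|cl x xK].
by apply/forall_inP => y yK; apply/implyP/cl.
Qed.

(** The union of a maximal family of disjoint cliques around [v] meets all the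
cliques around [v]. *)
Lemma fan_hit E q k v : 0 < q -> fan_free E q k.+1 ->
  exists S : {set V}, #|S| <= k * q /\
    forall K, #|K| = q -> v \notin K -> clique_in E (v |: K) ->
      ~~ [disjoint K & S].
Proof.
move=> q0 fE; suff go n Q : fan_at E q v Q -> k.+1 - #|Q| <= n ->
    exists S : {set V}, #|S| <= k * q /\
    forall K, #|K| = q -> v \notin K -> clique_in E (v |: K) ->
      ~~ [disjoint K & S].
  apply: (go k.+1 set0); last by rewrite leq_subr.
  split=> [|K]; last by rewrite inE.
  by apply: trivIset_intro => A B x; rewrite inE.
elim: n Q => [|n IH] Q fQ cQ; first by have := fE _ _ fQ; lia.
have [K|none] := pickP [pred K : {set V} | [&& #|K| == q, v \notin K,
    [forall x in v |: K, forall y in v |: K, (x != y) ==> adj E x y] &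
    [disjoint K & cover Q]]].
  case/and4P=> /eqP cK vK /clique_inP cl dK.
  have /card_gt0P[x xK] : 0 < #|K| by rewrite cK.
  apply: (IH (K |: Q)); last by rewrite (card_add xK dK); lia.
  case: fQ => tQ fQ; split; first exact: trivIset_add.
  by move=> L /setU1P[->|/fQ].
exists (cover Q); split.
  apply: leq_trans (card_cover_le (s := q) _) _.
    by case: fQ => _ fQ K /fQ[->].
  by rewrite leq_mul2r -ltnS (fE _ _ fQ) orbT.
move=> K cK vK /clique_inP cl; apply/negP => dK; have := none K.
by rewrite /= cK eqxx vK cl dK.
Qed.

(** Let [S v] be a small set that meets all the cliques of [q] vertices in the
neighbourhood of [v]. Choose a clique [x] of [q] vertices greedily, each vertex
off the sets [S] of the previous ones. The vertices joined to all of [x] are in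
the set [S] of its first vertex, so they are few, and by counting few vertices
miss two vertices of [x]. The others are sorted by the one vertex of [x] that
they miss. Two adjacent vertices of the same class and the vertices of [x] of the
other classes make a clique around a vertex of [x] that avoids its [S]; so the
classes are independent, up to a small exceptional set [U]. By the degrees, they
are then nearly completely joined. An exceptional vertex with many neighbours in
all the classes would have in its neighbourhood a clique avoiding its [S], so it
can be put in a class where it has few neighbours. *)
Lemma near_partition E W k q d : 1 < q -> E \subset pairs_in W ->
  fan_free E q k.+1 ->
  (forall v, v \in W -> #|W :\: nbr E v| <= d) ->
  q * d < #|W| + q -> q + k * q * q <= d ->
  exists p : V -> 'I_q,
    (forall v, v \in W ->
       #|crossmiss p E W v| <= (q + 2) * (3 * k * q + 2 * q) + k * q) /\
    (forall i, d < #|part p W i| + (3 * k * q + 2 * q)).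
Proof.
move=> q1 sE fE md qd bigd.
have pE : is_pairs E by move=> e /(subsetP sE); rewrite inE => /andP[/eqP].
have /fin_all_exists[S SP] v := fan_hit v (ltnW q1) fE.
have Shit v K : #|K| = q -> v \notin K -> clique_in E (v |: K) ->
    [disjoint K & S v] -> False.
  by move=> cK vK cl dK; have := (SP v).2 K cK vK cl; rewrite dK.
have cS v : #|S v| <= k * q by have [] := SP v.
have /card_gt0P[x00 x00W] : 0 < #|W|.
  have : q <= q * d by rewrite leq_pmulr //; lia.
  by lia.
pose R a b := adj E a b && (b \notin S a).
have [s [ss sW sR]] : exists s, [/\ size s = q, {subset s <= W} & pairwise R s].
  have: q <= q by [].
  elim: {1 3}q => [|t IH] tq; first by exists [::].
  have [s [ss sW sR]] := IH (ltnW tq).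
  pose bad := \bigcup_(a in [set a in s]) ((W :\: nbr E a) :|: S a).
  have cbad : #|bad| <= t * (d + k * q).
    apply: (@leq_trans (#|[set a in s]| * (d + k * q))).
      apply: card_bigcup_le => a; rewrite inE => /sW aW.
      by apply: leq_trans (card_setU_le _ _) _; rewrite leq_add ?md.
    by rewrite leq_mul2r cardsE -ss card_size orbT.
  have [b /setDP[bW bbad]] : exists b, b \in W :\: bad.
    apply/set0Pn; rewrite -card_gt0; have := cardsID bad W.
    have := subset_leq_card (subsetIr W bad).
    have : t * (d + k * q) <= q.-1 * (d + k * q) by rewrite leq_mul2r; lia.
    have : q.-1 * (d + k * q) + (d + k * q) = q * d + q * (k * q).
      by case: (q) q1 => // q' _ /=; lia.
    by lia.
  exists (rcons s b); split; first by rewrite size_rcons ss.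
    by move=> a; rewrite mem_rcons inE => /orP[/eqP->|/sW].
  rewrite pairwise_rcons sR andbT; apply/allP => a sa; rewrite /R.
  have ab : (b \notin W :\: nbr E a) && (b \notin S a).
    rewrite -negb_or -in_setU; apply: contra bbad => ab.
    by apply/bigcupP; exists a; rewrite // inE.
  by case/andP: ab => + ->; rewrite !inE bW andbT negbK => ->.
pose x (i : 'I_q) := nth x00 s i.
have xW i : x i \in W by rewrite sW // mem_nth ?ss.
have xR (i j : 'I_q) : i < j -> R (x i) (x j).
  by move=> ij; apply: (pairwiseP x00 sR); rewrite ?inE ?ss ?ltn_ord.
have xA i j : i != j -> adj E (x i) (x j).
  move=> nij; case: (ltngtP i j) => [/xR/andP[]//|/xR/andP[]|/val_inj eij].
    by rewrite adjC.
  by rewrite eij eqxx in nij.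
have x_inj : injective x.
  move=> i j eij; apply/eqP; apply: contraT => /xA/(adj_neq pE).
  by rewrite eij eqxx.
(* [o0] is the index of the first vertex of the clique, off whose [S] all the others
   are; [o1] plays this role for the class of [x o0], which is not joined to
   [x o0]. *)
pose o0 := Ordinal (ltnW q1); pose o1 := Ordinal q1.
pose miss y := [set i | ~~ adj E (x i) y].
pose Z := [set y in W | 1 < #|miss y|].
pose U := S (x o0) :|: S (x o1) :|: Z.
have miss0 y : y \in W -> y \notin S (x o0) -> 0 < #|miss y|.
  move=> yW yS; rewrite card_gt0; apply/eqP => m0.
  have ay i : adj E (x i) y.
    by have := in_set0 i; rewrite -m0 inE => /negbFE.
  have xy i : x i != y := adj_neq pE (ay i).
  apply: (@Shit (x o0) (y |: x @: [set~ o0])).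
  - rewrite cardsU1 card_imset // cardsC1 card_ord.
    case: imsetP => [[i _ ey]|_]; last by rewrite add1n prednK // ltnW.
    by have := xy i; rewrite ey eqxx.
  - rewrite in_setU1 negb_or xy; apply/imsetP => -[i + /x_inj ei].
    by rewrite !inE ei eqxx.
  - have clx a b : a \in y |: x @: setT -> b \in y |: x @: setT -> a != b -> adj E a b.
      move=> /setU1P[->|/imsetP[i _ ->]] /setU1P[->|/imsetP[j _ ->]] nab.
      + by rewrite eqxx in nab.
      + by rewrite adjC.
      + exact: ay.
      by apply: xA; apply: contra_neq nab => ->.
    have sub a : a \in x o0 |: (y |: x @: [set~ o0]) -> a \in y |: x @: setT.
      rewrite !in_setU1 => /or3P[/eqP->|->//|/imsetP[i _ ->]];
        by rewrite imset_f ?orbT // inE.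
    by move=> a b /sub ha /sub hb; apply: clx.
  rewrite -setI_eq0; apply/set0Pn => -[a /setIP[/setU1P[->|]]].
    by rewrite (negPf yS).
  case/imsetP => i; rewrite !inE => ni -> .
  have /xR/andP[_ /negPf->//] : o0 < i.
  by rewrite lt0n; apply: contra_neq ni => i0; apply/val_inj.
have sum_miss : \sum_(y in W) #|miss y| <= q * d.
  rewrite (eq_bigr (fun y => \sum_(i : 'I_q) ~~ adj E (x i) y)); last first.
    move=> y _; rewrite -sum1_card big_mkcond; apply: eq_bigr => i _.
    by rewrite inE; case: adj.
  rewrite exchange_big /= -[X in X * _]card_ord -sum_nat_const.
  apply: leq_sum => i _; apply: leq_trans (md _ (xW i)).
  rewrite -sum1_card big_mkcond [leqRHS]big_mkcond /=; apply: leq_sum => y _.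
  by rewrite !inE; case: (y \in W); case: adj.
have cZ : #|Z| < k * q + q.
  have : #|W| + #|Z| <= \sum_(y in W) #|miss y| + #|S (x o0)|.
    rewrite -(setIidPr (_ : Z \subset W)); last first.
      by apply/subsetP => y; rewrite inE => /andP[].
    rewrite -sum_mem_card -sum1_card -big_split /=.
    apply: (@leq_trans (\sum_(y in W) (#|miss y| + (y \in S (x o0))))).
      apply: leq_sum => y yW; rewrite !inE yW /=; have := miss0 y yW.
      by case: (y \in S _) => /=; case: (ltnP 1) => h1; lia.
    rewrite big_split /= leq_add2l sum_mem_card.
    exact/subset_leq_card/subsetIr.
  by have := cS (x o0); lia.
have cU : #|U| <= 3 * k * q + q.
  have := card_setU_le (S (x o0) :|: S (x o1)) Z.
  have := card_setU_le (S (x o0)) (S (x o1)).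
  by have := cS (x o0); have := cS (x o1); rewrite -/U; lia.
pose p0 y : 'I_q := odflt o0 [pick i in miss y].
have p0P y i : y \in W :\: U -> (adj E (x i) y) = (i != p0 y).
  rewrite !inE !negb_or => /andP[/andP[/andP[y0 _] +] yW].
  rewrite yW -leqNgt => m1; have m0 := miss0 y yW y0.
  have /cards1P[j mj] : #|miss y| == 1 by rewrite eqn_leq m1.
  have inm t : (t \in miss y) = (t == j) by rewrite mj inE.
  have -> : p0 y = j.
    rewrite /p0; case: pickP => [t|/(_ j)]; rewrite inm ?eqxx //.
    by move/eqP.
  by rewrite -(inm i) inE negbK.
pose Wc i := [set y in W :\: U | p0 y == i].
(* [c] exceeds by [q] the bound on the size of [U]; [q] is what is lost by rounding
   when [#|W|] is compared with [q * d]. *)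
pose c := 3 * k * q + 2 * q.
have Windep i y y' : y \in Wc i -> y' \in Wc i -> ~~ adj E y y'.
  move=> /setIdP[yWU /eqP py] /setIdP[y'WU /eqP py'].
  apply/negP => ayy'; pose j0 := if i == o0 then o1 else o0.
  have j0i : j0 != i by rewrite /j0; case: (i =P o0) => [->|/eqP]; rewrite // eq_sym.
  have xy j : j != i -> adj E (x j) y by rewrite p0P // py.
  have xy' j : j != i -> adj E (x j) y' by rewrite p0P // py'.
  have nyx j : j != i -> y != x j.
    by move=> /xy/(adj_neq pE); rewrite eq_sym.
  have ny'x j : j != i -> y' != x j.
    by move=> /xy'/(adj_neq pE); rewrite eq_sym.
  have ysS : (y \notin S (x j0)) && (y' \notin S (x j0)).
    move: yWU y'WU; rewrite !inE !negb_or /j0.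
    move=> /andP[/andP[/andP[y0 y1] _] _] /andP[/andP[/andP[y0' y1'] _] _].
    by case: (i == o0); apply/andP.
  pose K0 := x @: [set j | (j != i) && (j != j0)].
  have yK0 : y \notin K0.
    by apply/imsetP => -[j]; rewrite inE => /andP[/nyx + _] => /eqP.
  have y'K0 : y' \notin K0.
    by apply/imsetP => -[j]; rewrite inE => /andP[/ny'x + _] => /eqP.
  apply: (@Shit (x j0) (y |: (y' |: K0))).
  - rewrite cardsU1 in_setU1 negb_or (adj_neq pE ayy') yK0 cardsU1 y'K0 card_imset //.
    have -> : [set j | (j != i) && (j != j0)] = ~: [set i; j0].
      by apply/setP => j; rewrite !inE negb_or.
    by rewrite cardsCs setCK cards2 card_ord eq_sym j0i; clear -q1; lia.
  - rewrite !inE !negb_or ![x j0 == _]eq_sym nyx // ny'x //=.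
    by apply/imsetP => -[j + /x_inj ej]; rewrite inE -ej eqxx andbF.
  - have clx a b : a \in y |: (y' |: x @: [set~ i]) ->
        b \in y |: (y' |: x @: [set~ i]) -> a != b -> adj E a b.
      have ini t : t \in x @: [set~ i] -> exists2 j, j != i & t = x j.
        by case/imsetP=> j; rewrite !inE => ? ->; exists j.
      move=> /setU1P[->|/setU1P[->|/ini[j ji ->]]] /setU1P[->|/setU1P[->|/ini[j' ji' ->]]] nab //;
      rewrite ?eqxx // in nab *.
      + by rewrite adjC xy.
      + by rewrite adjC.
      + by rewrite adjC xy'.
      + exact: xy.
      + exact: xy'.
      by apply: xA; apply: contra_neq nab => ->.
    have sub a : a \in x j0 |: (y |: (y' |: K0)) -> a \in y |: (y' |: x @: [set~ i]).
      move=> /setU1P[->|/setU1P[->|/setU1P[->|/imsetP[j + ->]]]];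
        rewrite ?setU11 // !inE ?eqxx ?orbT //.
        by rewrite imset_f ?orbT // !inE.
      by case/andP=> ji _; rewrite imset_f ?orbT // !inE.
    by move=> a b /sub ha /sub hb; apply: clx.
  case/andP: ysS => yS y'S.
  rewrite -setI_eq0; apply/set0Pn => -[a /setIP[/setU1P[->|/setU1P[->|]]]].
  - by rewrite (negPf yS).
  - by rewrite (negPf y'S).
  case/imsetP => j; rewrite !inE => /andP[ji jj0] ->.
  have /xR/andP[_ /negPf->//] : j0 < j.
  move: jj0 ji; rewrite /j0; case: (i =P o0) => [->|_] jj0 ji /=.
    by rewrite ltn_neqAle lt0n -!val_eqE /= in jj0 ji *; rewrite eq_sym jj0.
  by rewrite lt0n; apply: contra_neq jj0 => j0'; apply/val_inj.
have WcW i : Wc i \subset W.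
  by apply/subsetP => y; rewrite !inE => /andP[/andP[]].
have sub_ub i : #|Wc i| <= d.
  apply: leq_trans (md _ (xW i)); apply/subset_leq_card/subsetP => y yc.
  rewrite !inE (subsetP (WcW i) _ yc) andbT.
  by move: yc; rewrite inE => /andP[/p0P-> /eqP->]; rewrite eqxx.
have sub_lb i : d < #|Wc i| + c.
  have : \sum_j #|Wc j| = #|W :\: U|.
    rewrite -[in RHS]sum1_card (partition_big p0 predT) //=.
    apply: eq_bigr => j _; rewrite -sum1_card; apply: eq_bigl => y.
    by rewrite !inE.
  rewrite (bigD1 i) //=.
  have : \sum_(j | j != i) #|Wc j| <= q.-1 * d.
    rewrite -[X in X.-1]card_ord -(cardC1 i) -sum_nat_const.
    by apply: leq_sum.
  have := cardsID U W; have := subset_leq_card (subsetIr W U).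
  have : q.-1 * d + d = q * d by rewrite addnC -mulSn prednK // ltnW.
  move: (q.-1 * d) (\sum_(j | j != i) _) => Y1 Y2; rewrite /c.
  by move: cU qd; clear; lia.
have far i y : y \in Wc i -> #|(W :\: nbr E y) :\: Wc i| <= c.
  move=> yc; have := cardsID (Wc i) (W :\: nbr E y).
  rewrite (setIidPr _); last first.
    apply/subsetP => u uc; rewrite !inE (subsetP (WcW i) _ uc) andbT.
    exact: Windep uc.
  by have := md _ (subsetP (WcW i) _ yc); have := sub_lb i; lia.
have low z : z \in W -> exists i, #|nbr E z :&: Wc i| <= (q + 1) * c + k * q.
  move=> zW; apply/existsP; apply: contraT; rewrite negb_exists => /forallP none.
  have [] := @transversal _ q E (fun i => nbr E z :&: Wc i :\: S z) c setT [set z] pE.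
  - by move=> a b /set1P-> /set1P->; rewrite eqxx.
  - move=> t i /set1P-> _; rewrite (_ : [set _ in _ | _] = set0) ?cards0 //.
    by apply/setP => u; rewrite !inE; case: adj; rewrite ?andbF.
  - move=> i j y _ _ nij /setDP[/setIP[_ yi] _]; apply: leq_trans (far _ _ yi).
    apply/subset_leq_card/subsetP => u; rewrite inE => /andP[/setDP[/setIP[_ uj] _] nyu].
    rewrite !inE nyu (subsetP (WcW j) _ uj) !andbT.
    apply: contra nij => /andP[_ /eqP <-]; move: uj; rewrite inE eq_sym.
    by case/andP.
  - move=> i _; rewrite cards1 cardsT card_ord addnC.
    have := none i; rewrite -ltnNge => big.
    have := cardsID (S z) (nbr E z :&: Wc i).
    have := subset_leq_card (subsetIr (nbr E z :&: Wc i) (S z)).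
    by have := cS z; lia.
  move=> Y [cY sY dY clY]; exfalso; apply: (@Shit z Y).
  - by rewrite cY cardsT card_ord.
  - by apply/negP => zY; have := disjointFr dY zY; rewrite set11.
  - exact: clY.
  rewrite -setI_eq0; apply/set0Pn => -[y /setIP[/sY[i _]]].
  by rewrite inE => /andP[/negPf->].
have /fin_all_exists[p1 p1P] (z : V) : exists i, z \in W ->
    #|nbr E z :&: Wc i| <= (q + 1) * c + k * q.
  by case: (boolP (z \in W)) => [/low[i]|_]; [exists i|exists o0].
pose p z := if z \in U then p1 z else p0 z.
have Wcp i u : u \in Wc i -> p u = i.
  by rewrite inE => /andP[/setDP[_ /negPf uU] /eqP]; rewrite /p uU.
exists p; split=> [z zW|i]; last first.
  apply: leq_trans (sub_lb i) _; rewrite leq_add2r.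
  apply/subset_leq_card/subsetP => y yi.
  by rewrite inE (subsetP (WcW i) _ yi) (Wcp i) /=.
have out : crossmiss p E W z \subset (W :\: nbr E z) :\: Wc (p z).
  apply/subsetP => u /setIdP[uW /andP[pu nz]]; apply/setDP; split.
    by rewrite in_setD uW inE nz.
  by apply: contra pu => /Wcp/eqP.
apply: leq_trans (subset_leq_card out) _; rewrite -/c.
have [zU|zU] := boolP (z \in U).
  have := p1P z zW; have -> : p1 z = p z by rewrite /p zU.
  have := cardsID (Wc (p z)) (W :\: nbr E z).
  have := cardsID (nbr E z) (Wc (p z)).
  have -> : (W :\: nbr E z) :&: Wc (p z) = Wc (p z) :\: nbr E z.
    apply/setP => u; rewrite in_setI !in_setD -andbA.
    case: (boolP (u \in Wc (p z))) => [/(subsetP (WcW _))->|] //.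
    by rewrite !andbF.
  rewrite [Wc _ :&: _]setIC.
  by have := md _ zW; have := sub_lb (p z); lia.
apply: leq_trans (far (p z) z _) _; first by rewrite inE in_setD zU zW /p (negPf zU) /=.
by lia.
Qed.

End Structure.

(** * Pairs between distinct parts *)

Section CrossPairs.
Variables (V : finType) (q : nat).
Implicit Types (E H Q Ts : {set {set V}}) (A L X K T W : {set V}) (v x y z : V)
  (p : V -> 'I_q).

Definition cross p := [set e : {set V} | (#|e| == 2) && (#|p @: e| == 2)].

Lemma in_cross p x y : ([set x; y] \in cross p) = (p x != p y).
Proof.
rewrite inE imsetU1 imset_set1 !cards2; case: (x =P y) => [->|_].
  by rewrite eqxx.
by case: (p x == p y).
Qed.

Lemma cross_pairs p : is_pairs (cross p).
Proof. by move=> e; rewrite inE => /andP[/eqP]. Qed.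

Lemma sum_parts p W : \sum_i #|part p W i| = #|W|.
Proof.
rewrite -[RHS]sum1_card (partition_big p predT) //=.
by apply: eq_bigr => j _; rewrite -sum1_card; apply: eq_bigl => y; rewrite inE.
Qed.

(** The vertices off [W] are added one by one to the currently smallest part, so
that the [j]-th one is joined to at least [j - j %/ q] vertices. *)
Lemma part_extend p W : 0 < q ->
  exists p' : V -> 'I_q, {in W, p' =1 p} /\
    \sum_(#|W| <= j < #|V|) (j - j %/ q) <= #|cross p' :\: pairs_in W|.
Proof.
move=> q0; have [m] := ubnP #|~: W|; elim: m p W => // m IH p W Wm.
have [W0|[v vW]] := set_0Vmem (~: W).
  exists p; split=> //; rewrite big_geq // -(cardsC W) W0 cards0 addn0.
  by rewrite leqnn.
rewrite inE in vW.
have [i ci] : exists i, #|part p W i| <= #|W| %/ q.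
  case: (arg_minnP (P := predT) (i0 := Ordinal q0) (fun i => #|part p W i|)) => // i _ mi.
  exists i; rewrite leq_divRL // mulnC -{1}[q]card_ord -sum_nat_const -(sum_parts p W).
  by apply: leq_sum => j _; apply: mi.
pose p1 x := if x == v then i else p x.
have cW1 : #|v |: W| = #|W|.+1 by rewrite cardsU1 vW.
have [] := IH p1 (v |: W).
  by have := cardsC W; have := cardsC (v |: W); rewrite cW1; lia.
move=> p' [p'1 p'2]; exists p'; split.
  move=> x xW; rewrite p'1 ?setU1r // /p1; case: eqP => // exv.
  by rewrite exv (negPf vW) in xW.
have Wn : #|W| < #|V| by rewrite -cW1 max_card.
have p'v : p' v = i by rewrite p'1 ?setU11 // /p1 eqxx.
rewrite big_ltn //; rewrite cW1 in p'2.
pose N := [set [set v; u] | u in W :\: part p W i].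
have cN : #|N| = #|W| - #|part p W i|.
  rewrite card_in_imset.
    rewrite cardsD (setIidPr _) //.
    by apply/subsetP => x; rewrite inE => /andP[].
  move=> x y /setDP[xW _] _ /setP/(_ x); rewrite !inE eqxx orbT.
  by move=> /esym/orP[/eqP exv|/eqP //]; rewrite -exv xW in vW.
have dN : [disjoint N & cross p' :\: pairs_in (v |: W)].
  rewrite -setI_eq0; apply/set0Pn => -[e /setIP[/imsetP[u /setDP[uW _] ->]]].
  rewrite !inE subUset !sub1set !inE eqxx uW orbT cards2.
  by case: (v =P u) => // evu; rewrite evu uW in vW.
apply: (@leq_trans #|N :|: (cross p' :\: pairs_in (v |: W))|).
  rewrite cardsU (disjoint_setI0 dN) cards0 subn0 cN leq_add // leq_sub //.
apply/subset_leq_card/subsetP => e /setUP[/imsetP[u]|].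
  rewrite !in_setD => /andP[uN uW] ->.
  rewrite !in_cross !inE subUset !sub1set (negPf vW) andbF /= p'v.
  have p'u : p' u = p u.
    rewrite p'1 ?setU1r // /p1; case: eqP => // euv.
    by rewrite euv (negPf vW) in uW.
  by rewrite p'u; apply: contra uN => /eqP->; rewrite inE uW eqxx.
rewrite !in_setD => /andP[+ ->]; rewrite andbT; apply: contra.
rewrite !inE => /andP[-> /subset_trans-> //]; exact: subsetUr.
Qed.

Definition bipartite_pairs A L := [set [set al.1; al.2] | al in setX A L].

Lemma card_bipartite_pairs A L : [disjoint A & L] ->
  #|bipartite_pairs A L| = #|A| * #|L|.
Proof.
move=> dAL; rewrite -cardsX card_in_imset // => -[a l] [a' l'] /setXP[aA lL] /setXP[a'A l'L].
move=> /setP/= eal.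
have := eal a; have := eal l; rewrite !inE !eqxx orbT.
have ll' : l != a' by apply/eqP => e; have := disjointFr dAL a'A; rewrite -e lL.
have aa' : a != l' by apply/eqP => e; have := disjointFr dAL aA; rewrite e l'L.
by rewrite (negPf ll') (negPf aa') orbF => /esym/eqP-> /esym/eqP->.
Qed.

(** A seed and its centre contain an edge of the bipartite graph, whose ends are
all in one part. For a centre in [A], the seeds are distinct vertices of [L], and vice
versa; for a centre off this part, they are disjoint pairs meeting [A]. *)
Lemma cross_bipartite_fan_free p A L i k : [disjoint A & L] ->
  (forall x, x \in A :|: L -> p x = i) -> #|A| < k -> #|L| < k ->
  fan_free (cross p :|: bipartite_pairs A L) q k.
Proof.
move=> dAL pi cA cL v Q fQ; have [Ts [[tT sd] <-]] := fan_seeds p fQ.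
pose X := if v \in A then L else A.
have cX : #|X| < k by rewrite /X; case: ifP.
apply: leq_ltn_trans cX; apply: leq_hitting => // T /sd[cl].
have inner x y : p x = p y -> adj (cross p :|: bipartite_pairs A L) x y ->
    (x \in A /\ y \in L) \/ (x \in L /\ y \in A).
  move=> pxy; rewrite /adj inE in_cross pxy eqxx /= => /imsetP[[a l] /setXP[/= aA lL] exy].
  have nal : a != l by apply/eqP => e; have := disjointFr dAL aA; rewrite e lL.
  have := set21 x y; rewrite exy => /set2P[ex|ex].
    left; have := set22 a l; rewrite -exy => /set2P[e|e].
      by rewrite e ex eqxx in nal.
    by rewrite ex -e.
  right; have := set21 a l; rewrite -exy => /set2P[e|e].
    by rewrite e ex eqxx in nal.
  by rewrite ex -e.
move: cl => /[swap] -[[u [-> nuv puv]]|[a [b [-> nab pab pav]]]] cl.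
  have avu : adj (cross p :|: bipartite_pairs A L) v u.
    by apply: cl; rewrite ?inE ?eqxx ?orbT // eq_sym.
  rewrite /X; case: (inner v u (esym puv) avu) => -[vA uL].
    by exists u; rewrite ?set11 // vA.
  by rewrite (disjointFl dAL vA); exists u; rewrite ?set11.
have aab : adj (cross p :|: bipartite_pairs A L) a b.
  by apply: cl; rewrite ?inE ?eqxx ?orbT.
have := inner a b pab aab.
have vA : v \notin A.
  apply/negP => vA; move: pav => /eqP[]; rewrite (pi v) ?inE ?vA //.
  by case: (inner a b pab aab) => -[h _]; rewrite pi // inE h ?orbT.
rewrite /X (negPf vA) => -[[h _]|[_ h]]; first by exists a; rewrite ?inE ?eqxx.
by exists b; rewrite ?inE ?eqxx ?orbT.
Qed.

End CrossPairs.

(** * An inequality on matching numbers *)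

(** The two dominant parts: [a] and [s] are matching numbers less than [K], and
[K ^ 2 - a * K - s * K + a * s] is the product of [K - a] and [K - s]. *)
Lemma two_part_weight a s K : a < K -> s < K -> a * (2 * K - s) + s * (2 * K - a) < 2 * K ^ 2.
Proof.
move=> aK sK; have [x ex] : exists x, K = a + x.+1 by exists (K - a.+1); lia.
have [y ey] : exists y, K = s + y.+1 by exists (K - s.+1); lia.
have e1 : 2 * K - s = K + y.+1 by lia.
have e2 : 2 * K - a = K + x.+1 by lia.
rewrite e1 e2.
have : K ^ 2 = a * K + x.+1 * K by rewrite -mulnDl -ex mulnn.
have : K ^ 2 = s * K + y.+1 * K by rewrite -mulnDl -ey mulnn.
have : x.+1 * K = x.+1 * s + x.+1 * y.+1 by rewrite -mulnDr -ey.
have : y.+1 * K = y.+1 * a + y.+1 * x.+1 by rewrite -mulnDr -ex.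
lia.
Qed.
Lemma two_part_weight1 a K : 1 < K -> a < K -> a * (2 * K) + (2 * K - a) < 2 * K ^ 2.
Proof.
move=> K1 aK; have [x ex] : exists x, K = a + x.+1 by exists (K - a.+1); lia.
have e2 : 2 * K - a = K + x.+1 by lia.
have : K ^ 2 = a * K + x.+1 * K by rewrite -mulnDl -ex mulnn.
have : x.+1 * 2 <= x.+1 * K by rewrite leq_mul2l K1.
have : K <= x.+1 * K by rewrite leq_pmull.
rewrite e2; lia.
Qed.

(** Here [nu i] is the matching number of the inner graph of part [i], whose
degrees are at most [k.-1], and at most [k.-1] minus the sum of the [nu j] over
the other parts when no cross pair is missing; [w i] is twice the cost of an edge
of a maximum matching in [weighted_edge_bound]. The conclusion says that there
are fewer than [k.-1 ^ 2] inner edges, the size of the complete bipartite graph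
that is put in one part for the lower bound. All the gain comes from the
hypothesis on [nu], which improves by one what the lack of fans gives. *)
Lemma matching_weights q (nu : 'I_q -> nat) k : 1 < q ->
  (forall i, \sum_(j | j != i) nu j + 2 <= k) ->
  exists w : 'I_q -> nat,
    [/\ forall i, k.-1 + (k.-1 - \sum_(j | j != i) nu j) <= w i,
        forall i s, (2 * s + 1) * minn (2 * s) (k.-1 - \sum_(j | j != i) nu j)
                    <= s * w i &
        \sum_i nu i * w i < 2 * k.-1 ^ 2].
Proof.
move=> q1 Sk; set S := fun i : 'I_q => \sum_(j | j != i) nu j.
have {}Sk i : S i + 2 <= k by apply: Sk.
pose K := k.-1; have kK : k = K.+1.
  by have := Sk (Ordinal q1); rewrite /K; case: (k) => //; lia.
have SK i : S i < K by have := Sk i; rewrite kK; lia.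
(* A component of maximum degree [d] has at most [d + 1] edges for each edge of a
   maximum matching, and this cost dominates only if at most one edge of the
   matchings is in the other parts; for [d = 1] it drops to [3 / 2], which
   matters when [K] is [2]. *)
pose w i := if S i == 0 then 2 * K + 2 else
            if S i == 1 then (if K == 2 then 3 else 2 * K) else 2 * K - S i.
exists w; split=> [i|i s|]; rewrite -/(S _) -/K.
- rewrite /w; case: eqP => [->|_]; first by lia.
  case: eqP => [->|_]; last by have := SK i; lia.
  by case: eqP; lia.
- have H d : (2 * s + 1) * minn (2 * s) d <= s * (2 * d + 2).
    by rewrite /minn; case: ltnP => h; nia.
  rewrite /w; have := SK i; case: eqP => [->|S0].
    by rewrite subn0 => _; apply: leq_trans (H _) _.
  case: eqP => [->|S1]; last first.
    by move=> SiK; apply: leq_trans (H _) _; rewrite leq_mul2l; apply/orP; right; lia.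
  case: eqP => [->|K2]; last first.
    by move=> SiK; apply: leq_trans (H _) _; rewrite leq_mul2l; apply/orP; right; lia.
  by case: s {H} => [|s] _; rewrite /minn; case: ltnP; lia.
have SE i : S i = \sum_(j | j != i) nu j by [].
have tot j : S j + nu j = \sum_i nu i by rewrite SE addnC [RHS](bigD1 j).
have geS i j : j != i -> nu j <= S i.
  by move=> ji; rewrite SE (bigD1 j) //= leq_addr.
have K0 : 0 < K by have := SK (Ordinal q1); lia.
case: (arg_maxnP (P := predT) (i0 := Ordinal q1) nu) => // i1 _ max1.
rewrite (bigD1 i1) //=.
have S1s j : j != i1 -> nu i1 <= S j by move=> ji; apply: geS; rewrite eq_sym.
have [j0 j0i] : exists j0, j0 != i1.
  have [e|] := eqVneq (Ordinal q1) i1; last by exists (Ordinal q1).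
  by exists (Ordinal (ltnW q1)); rewrite -e.
have n1K : nu i1 < K by apply: leq_ltn_trans (S1s _ j0i) (SK _).
have [Si0|Sn0] := eqVneq (S i1) 0.
  rewrite big1 => [|j ji]; last first.
    by move: (geS _ _ ji); rewrite Si0 leqn0 => /eqP->.
  by rewrite /w Si0 /= addn0; nia.
have sumle B : (forall j, j != i1 -> 0 < nu j -> w j <= B) ->
    \sum_(j | j != i1) nu j * w j <= S i1 * B.
  move=> wB; rewrite SE big_distrl /=; apply: leq_sum => j ji.
  by case: (posnP (nu j)) => [->|/(wB _ ji)]; rewrite // leq_mul2l => ->; rewrite orbT.
have [v2|v1] := leqP 2 (nu i1 + S i1 - 1).
  have Hw : forall j, j != i1 -> 0 < nu j -> w j <= 2 * K - nu i1.
    move=> j ji nj; have := S1s _ ji; have nS : nu j <= nu i1 := max1 j isT.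
    have : S j + nu j = nu i1 + S i1 by rewrite tot -(tot i1) addnC.
    move=> Stot S1j; rewrite /w; case: (S j =P 0) => [Sj|_]; first by exfalso; lia.
    case: (S j =P 1) => [Sj|_]; first by exfalso; lia.
    by lia.
  have := sumle _ Hw; have := SK i1; rewrite /w (negPf Sn0).
  case: (S i1 =P 1) => [-> K1|S1 SK1]; last first.
    by move=> le1; apply: leq_ltn_trans (two_part_weight n1K SK1); apply: leq_add.
  rewrite mul1n => le1; apply: leq_ltn_trans (two_part_weight1 K1 n1K).
  by apply: leq_add le1; rewrite leq_mul2l; case: (K =P 2) => [->|_]; rewrite ?leqnn orbT.
have [v0|v0] := posnP (nu i1).
  rewrite v0 mul0n add0n big1 => [|j ji]; first by nia.
  by have : nu j <= nu i1 := max1 j isT; rewrite v0 leqn0 => /eqP->.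
have n1 : nu i1 = 1 by lia.
have S1 : S i1 = 1 by lia.
have Hw : forall j, j != i1 -> 0 < nu j -> w j <= w i1.
  move=> j ji nj; have nS : nu j <= nu i1 := max1 j isT.
  have : S j + nu j = nu i1 + S i1 by rewrite tot -(tot i1) addnC.
  have -> : S i1 = 1 by [].
  move=> Sj; have {}Sj : S j = 1 by lia.
  by rewrite /w Sj S1.
have := sumle _ Hw; rewrite S1 n1 !mul1n /w S1 /=.
by move: n1K; rewrite n1; case: eqP => [->|]; nia.
Qed.

(** * Inner and cross pairs of a graph with a vertex partition *)

Section Partitioned.
Variables (V : finType) (q : nat) (p : V -> 'I_q) (W : {set V}).
Hypothesis q0 : 0 < q.
Implicit Types (E H Q Ts M : {set {set V}}) (A L X K T e : {set V}) (v x y z : V)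
  (i j : 'I_q) (F : 'I_q -> {set {set V}}).

Definition inner_in E i := [set e in E | e \subset part p W i].

Definition inner E := E :\: cross p.

Definition missed E := (cross p :&: pairs_in W) :\: E.

(** For a pair inside a part, this is that part; the default value only
matters for the empty set. *)
Definition pair_part e : 'I_q :=
  odflt (Ordinal q0) (omap p [pick x in e]).

Lemma sub_pairs E : E \subset pairs_in W -> is_pairs E.
Proof. by move=> sE e /(subsetP sE); rewrite inE => /andP[/eqP]. Qed.

Lemma adj_in E x y : E \subset pairs_in W -> adj E x y -> (x \in W) && (y \in W).
Proof.
by move=> sE /(subsetP sE); rewrite inE subUset !sub1set => /andP[].
Qed.

Lemma pair_part_in e i x : e \subset part p W i -> x \in e -> pair_part e = i.
Proof.
move=> /subsetP si xe; rewrite /pair_part; case: pickP => [y /si|/(_ x)].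
  by rewrite inE => /andP[_ /eqP].
by rewrite xe.
Qed.

Lemma inner_in_pairs E i : is_pairs E -> is_pairs (inner_in E i).
Proof. by move=> pE e; rewrite inE => /andP[/pE]. Qed.

Lemma inner_inP E i e : is_pairs E -> e \in inner_in E i ->
  exists a b, [/\ e = [set a; b], a != b, p a = i, p b = i & adj E a b].
Proof.
move=> pE; rewrite inE => /andP[Ee se].
have /eqP/cards2P[a [b [nab De]]] := pE _ Ee.
have pi x : x \in e -> p x = i.
  by move=> /(subsetP se); rewrite inE => /andP[_ /eqP].
by exists a, b; rewrite -?De /adj -?De; split; rewrite // pi // De !inE eqxx ?orbT.
Qed.

Lemma inner_in_part E i e : is_pairs E -> e \in inner_in E i -> pair_part e = i.
Proof.
move=> pE Ee; have [a [b [De _ _ _ _]]] := inner_inP pE Ee.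
move: Ee; rewrite inE => /andP[_ /pair_part_in]; apply; rewrite De.
exact: set21.
Qed.

Lemma card_by_part (P : pred {set V}) (M : 'I_q -> {set {set V}}) :
  (forall i e, e \in M i -> pair_part e = i) ->
  #|[set e | (e \in M (pair_part e)) && P e]| =
  \sum_i #|[set e in M i | P e]|.
Proof.
move=> Mi; rewrite -sum1_card (partition_big pair_part predT) //=.
apply: eq_bigr => i _; rewrite -sum1_card; apply: eq_bigl => e.
rewrite !inE; apply/andP/andP => [[/andP[+ ->] /eqP ei]|[ei ->]].
  by rewrite ei.
by rewrite (Mi _ _ ei) ei.
Qed.

Lemma card_inner E : E \subset pairs_in W ->
  #|inner E| = \sum_i #|inner_in E i|.
Proof.
move=> sE; have pE := sub_pairs sE.
transitivity (#|[set e | (e \in inner_in E (pair_part e)) && true]|).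
  apply/eq_card => e; rewrite in_setD.
  have -> : (e \in [set e | (e \in inner_in E (pair_part e)) && true]) =
      (e \in E) && (e \subset part p W (pair_part e)) by rewrite !inE andbT.
  rewrite andbC.
  case: (boolP (e \in E)) => //= Ee.
  have /eqP/cards2P[a [b [nab De]]] := pE _ Ee.
  have := subsetP sE _ Ee; rewrite inE De subUset !sub1set => /andP[_ /andP[aW bW]].
  have pe : (pair_part [set a; b] == p a) || (pair_part [set a; b] == p b).
    rewrite /pair_part; case: pickP => [y|/(_ a)]; last by rewrite !inE eqxx.
    by rewrite !inE /= => /orP[]/eqP->; rewrite eqxx ?orbT.
  rewrite in_cross subUset !sub1set [a \in _]in_set [b \in _]in_set aW bW /= negbK.
  case/orP: pe => /eqP->; rewrite eqxx ?andbT //.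
rewrite card_by_part; last by move=> i e; apply: inner_in_part.
by apply: eq_bigr => i _; apply: eq_card => e; rewrite !inE andbT.
Qed.

Lemma card_cross_split E : E \subset pairs_in W ->
  #|E| + #|missed E| = #|inner E| + #|cross p :&: pairs_in W|.
Proof.
move=> sE; rewrite -(cardsID (cross p) E) /inner /missed.
have -> : E :&: cross p = (cross p :&: pairs_in W) :&: E.
  apply/setP => e; rewrite !in_setI; case: (boolP (e \in E)) => [/(subsetP sE)->|].
    by rewrite !andbT.
  by rewrite !andbF.
by rewrite -(cardsID E (cross p :&: pairs_in W)) addnAC addnC.
Qed.

Lemma sum_crossmiss E :
  \sum_(v in W) #|crossmiss p E W v| = 2 * #|missed E|.
Proof.
have pM : is_pairs (missed E).
  by move=> e /setDP[/setIP[/cross_pairs]].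
rewrite -(handshake pM) [RHS](bigID (mem W)) /= [X in _ + X]big1 ?addn0.
  apply: eq_bigr => v vW; rewrite deg_nbr //; apply: eq_card => u.
  rewrite !inE -/(adj _ _ _); rewrite /adj !in_setD !in_setI in_cross inE.
  rewrite subUset !sub1set vW cards2 eq_sym.
  have [->|nuv] := eqVneq v u; first by rewrite eqxx andbF !andFb ?andbF.
  by rewrite /=; case: (p v == p u); case: (u \in W); case: (_ \in E).
move=> v vW; rewrite deg_nbr //; apply/eqP; rewrite cards_eq0; apply/eqP/setP => u.
rewrite !inE; apply/negP => /setDP[/setIP[_]].
by rewrite inE subUset !sub1set (negPf vW) andbF.
Qed.

Lemma deg_inner_in E i v : p v != i ->
  deg (inner_in E i) v = 0.
Proof.
move=> nvi; apply/eqP; rewrite cards_eq0; apply/eqP/setP => e; rewrite !inE.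
apply/negP => /andP[/andP[_ /subsetP si] /si]; rewrite inE => /andP[_].
by rewrite (negPf nvi).
Qed.

(** A star in the part of [v] and a matching in the other parts compete for the
same seeds: their sizes add up. *)
Lemma build_seeds E v (S : {set V}) M :
  (forall u, u \in S -> [/\ u != v, p u = p v & adj E v u]) ->
  trivIset M ->
  (forall e, e \in M -> exists a b, [/\ e = [set a; b], a != b, p a = p b,
     p a != p v & [/\ adj E a b, adj E v a & adj E v b]]) ->
  seeds_at p E v ([set [set u] | u in S] :|: M) /\
  #|[set [set u] | u in S] :|: M| = #|S| + #|M|.
Proof.
move=> Sv tM Mv.
have pM e x : e \in M -> x \in e -> p x != p v.
  by move=> /Mv[a [b [-> _ pab pav _]]] /set2P[]->; rewrite -?pab.
have dSM e u : e \in M -> u \in S -> u \in e -> False.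
  by move=> Me /Sv[_ puv _] /(pM _ _ Me); rewrite puv eqxx.
split; last first.
  rewrite cardsU card_imset; last exact: set1_inj.
  rewrite (_ : _ :&: M = set0) ?cards0 ?subn0 //.
  apply/setP => e; rewrite !inE; apply/negP => /andP[/imsetP[u uS ->] Mu].
  exact: dSM Mu uS (set11 u).
split.
  apply: trivIset_intro => A B x /setUP[/imsetP[u uS ->]|MA] /setUP[/imsetP[w wS ->]|MB].
  - by move=> /set1P<- /set1P<-.
  - by move=> /set1P-> ub; case: (dSM _ _ MB uS ub).
  - by move=> wa /set1P e; rewrite e in wa; case: (dSM _ _ MA wS wa).
  exact: trivIset_eq tM MA MB.
move=> T /setUP[/imsetP[u /Sv[nuv puv avu] ->]|/Mv[a [b [-> nab pab pav [aab ava avb]]]]].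
  split; last by left; exists u.
  move=> x y /setU1P[->|/set1P->] /setU1P[->|/set1P->] nxy; rewrite ?eqxx // in nxy *.
  by rewrite adjC.
split; last by right; exists a, b.
by move=> x y /setU1P[->|/set2P[->|->]] /setU1P[->|/set2P[->|->]] nxy;
  rewrite ?eqxx // in nxy *; rewrite adjC.
Qed.

Lemma inner_degree_lt E v k :  E \subset pairs_in W ->
  (forall Ts, seeds_at p E v Ts -> #|Ts| < k) ->
  deg (inner_in E (p v)) v < k.
Proof.
move=> sE ns; have pE := sub_pairs sE.
have [] := @build_seeds E v (nbr (inner_in E (p v)) v) set0.
- move=> u; rewrite inE /adj inE => /andP[avu]; rewrite subUset !sub1set !inE.
  move=> /andP[_ /andP[_ /eqP pu]]; split=> //.
  by rewrite eq_sym (adj_neq pE avu).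
- by apply: trivIset_intro => A B x; rewrite inE.
- by move=> e; rewrite inE.
by move=> /ns + e; rewrite e cards0 addn0 -deg_nbr //; apply: inner_in_pairs.
Qed.

Definition crossing_matching E F :=
  forall i, F i \subset inner_in E i /\ trivIset (F i).

Definition union_of F := [set e | e \in F (pair_part e)].

Lemma union_trivIset E F : crossing_matching E F ->
  trivIset (union_of F).
Proof.
move=> mM; apply: trivIset_intro => A B x; rewrite !inE => MA MB xA xB.
have [sA tA] := mM (pair_part A); have [sB tB] := mM (pair_part B).
have AB : pair_part A = pair_part B.
  have:= subsetP sA _ MA; have := subsetP sB _ MB; rewrite !inE.
  move=> /andP[_ /subsetP/(_ _ xB)] + /andP[_ /subsetP/(_ _ xA)].
  by rewrite !inE => /andP[_ /eqP<-] /andP[_ /eqP<-].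
by rewrite -AB in MB; apply: trivIset_eq tA MA MB xA xB.
Qed.

Lemma union_sub E F e : is_pairs E -> crossing_matching E F ->
  e \in union_of F -> e \in inner_in E (pair_part e).
Proof. by move=> pE mM; rewrite inE; apply: subsetP; case: (mM (pair_part e)). Qed.

Lemma card_union_off E F i : is_pairs E -> crossing_matching E F ->
  #|[set e in union_of F | pair_part e != i]| = \sum_(j | j != i) #|F j|.
Proof.
move=> pE mM.
have Mj j e : e \in F j -> pair_part e = j.
  by case: (mM j) => /subsetP sM _ /sM; apply: inner_in_part.
transitivity #|[set e | (e \in F (pair_part e)) && (pair_part e != i)]|.
  by apply: eq_card => e; rewrite !inE.
rewrite card_by_part // [RHS]big_mkcond /=; apply: eq_bigr => j _.
case: (j =P i) => [->|/eqP ji] /=.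
  apply/eqP; rewrite cards_eq0; apply/eqP/setP => e; rewrite !inE.
  by apply/negP => /andP[/Mj->]; rewrite eqxx.
by apply: eq_card => e; rewrite !inE; case: (boolP (e \in F j)) => // /Mj->; rewrite ji.
Qed.

(** The edges of a matching that are not joined to [v] contain distinct vertices
missed by [v]; the other ones are seeds, with the inner neighbours of [v]. *)
Lemma degree_plus_matching E F v k : E \subset pairs_in W ->
  (forall Ts, seeds_at p E v Ts -> #|Ts| < k) ->
  crossing_matching E F ->
  deg (inner_in E (p v)) v + \sum_(j | j != p v) #|F j| <
    k + #|crossmiss p E W v|.
Proof.
move=> sE ns mM; have pE := sub_pairs sE.
pose M0 := [set e in union_of F | pair_part e != p v].
pose M1 := [set e in M0 | e \subset nbr E v].
have tM := union_trivIset mM.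
have tM0 : trivIset M0 by apply: trivIsetS tM; apply/subsetP => e; rewrite inE => /andP[].
have M0P e : e \in M0 -> exists a b, [/\ e = [set a; b], a != b, p a = p b,
     p a != p v & adj E a b].
  rewrite inE => /andP[/(union_sub pE mM) Ee nv].
  have [a [b [De nab pa pb aab]]] := inner_inP pE Ee.
  by exists a, b; rewrite pa pb.
have [] := @build_seeds E v (nbr (inner_in E (p v)) v) M1.
- move=> u; rewrite inE /adj inE => /andP[avu]; rewrite subUset !sub1set !inE.
  move=> /andP[_ /andP[_ /eqP pu]]; split=> //.
  by rewrite eq_sym (adj_neq pE avu).
- by apply: trivIsetS tM0; apply/subsetP => e; rewrite inE => /andP[].
- move=> e; rewrite inE => /andP[/M0P[a [b [-> nab pab pav aab]]]].
  by rewrite subUset !sub1set !inE => /andP[ava avb]; exists a, b.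
move=> /ns + eTs; rewrite eTs -deg_nbr; last exact: inner_in_pairs.
rewrite -(card_union_off (p v) pE mM) -/M0 -(cardsID (powerset (nbr E v)) M0).
have -> : M0 :&: powerset (nbr E v) = M1.
  by apply/setP => e; rewrite in_setI powersetE [e \in M1]in_set.
have : #|M0 :\: powerset (nbr E v)| <= #|crossmiss p E W v|.
  apply: leq_hitting; first by apply: trivIsetS tM0; rewrite subsetDl.
  move=> e /setDP[Me]; rewrite powersetE => /subsetPn[x xe]; rewrite inE => nvx.
  exists x => //; have [a [b [De nab pab pav aab]]] := M0P _ Me.
  have /andP[aW bW] := adj_in sE aab.
  by move: xe; rewrite inE nvx De => /set2P[]->; rewrite ?aW ?bW -?pab pav.
by move=> le2 le1; rewrite addnA -addSn; apply: leq_add.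
Qed.

End Partitioned.

(** * Colourings without a rainbow fan, with at least two parts *)

(** Here [X] stands for the extremal number, [W] for the vertices of large colour
degree, and [G] contains one edge of each colour that appears in [W]. The cross
pairs off [W] make up for the colours that do not appear in [W]. The last three
hypotheses say that the parts are large with respect to [k], [q] and [m]. *)
Section Coloring.
Variables (V C : finType) (c : {set V} -> C) (q k X : nat).
Hypotheses (q1 : 1 < q) (k0 : 0 < k).
Hypothesis no_rainbow : forall E : {set {set V}},
  is_pairs E -> {in E &, injective c} -> fan_free E q k.+1.
Hypothesis ex_bound : forall H : {set {set V}},
  is_pairs H -> fan_free H q k -> #|H| <= X.
Variables (W : {set V}) (G : {set {set V}}) (p : V -> 'I_q) (m : nat).
Hypotheses (sG : G \subset pairs_in W) (injG : {in G &, injective c}).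
Hypothesis miss_le : forall v, v \in W -> #|crossmiss p G W v| <= m.
Hypothesis many_colors : X + 2 <= #|G| + #|cross p :\: pairs_in W|.
Hypothesis part_fan : forall i,
  (q + 1) * (m + k.+1) + (k.+1 * (q + 2) + 1) < #|part p W i|.
Hypothesis part_generic : forall i,
  k * (2 * k + 4) + 2 * k + 2 + 4 * k * k.+1 <= #|part p W i|.
Hypothesis part_matching : forall i, 2 * k.+1 * m < #|part p W i|.

Implicit Types (E H Q Ts M : {set {set V}}) (A L Y K T e : {set V})
  (v x y z : V) (i j : 'I_q) (cs : {set C}).

Let q0 : 0 < q := ltnW q1.

Definition without cs := [set e in G | c e \notin cs].

Definition touched cs := cover (G :\: without cs).

Lemma without_sub cs : without cs \subset G.
Proof. by apply/subsetP => e; rewrite inE => /andP[]. Qed.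

Lemma card_removed cs : #|G :\: without cs| <= #|cs|.
Proof.
rewrite -(card_in_imset (f := c)) => [|e f /setDP[Ge _] /setDP[Gf _]]; last exact: injG.
apply/subset_leq_card/subsetP => _ /imsetP[e + ->].
by rewrite in_setD in_set => /andP[+ Ge]; rewrite Ge /= negbK.
Qed.

Lemma card_touched cs : #|touched cs| <= #|cs| * 2.
Proof.
apply: leq_trans (card_cover_le (s := 2) _) _; last first.
  by rewrite leq_mul2r card_removed orbT.
by move=> e /setDP[/(subsetP sG)]; rewrite inE => /andP[/eqP->].
Qed.

Lemma near_without E cs v : without cs \subset E -> v \in W ->
  #|crossmiss p E W v| <= m + #|cs|.
Proof.
move=> sE vW; pose D := G :\: without cs.
have pD : is_pairs D by move=> e /setDP[/(sub_pairs sG)].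
apply: (@leq_trans #|crossmiss p G W v :|: nbr D v|).
  apply/subset_leq_card/subsetP => u /setIdP[uW /andP[pu nE]].
  rewrite in_setU [u \in nbr D v]in_set [u \in crossmiss _ _ _ _]in_set uW pu /=.
  rewrite /adj in_setD; case: (boolP ([set v; u] \in G)) => //= _.
  by rewrite andbT; apply: contra nE => /(subsetP sE).
apply: leq_trans (card_setU_le _ _) _; apply: leq_add; first exact: miss_le.
rewrite -deg_nbr //; apply: leq_trans (card_removed cs).
by apply/subset_leq_card/subsetP => e; rewrite inE => /andP[].
Qed.

(** A graph that contains all the edges of [G] but those of a few colours is still
nearly complete between the parts, so [seeds_fan] applies to it. *)
Lemma rainbow_seeds E cs v Ts : E \subset pairs_in W -> {in E &, injective c} ->
  without cs \subset E -> #|cs| <= k.+1 -> seeds_at p E v Ts -> k < #|Ts| ->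
  False.
Proof.
move=> sE injE sGE ck sT kT.
have [Ts' sT' cT'] := subfamily_of_card kT.
have [x xW|i||Q [fQ cQ]] := @seeds_fan _ _ p E W (m + k.+1) k.+1 v Ts' sE _ _
  (seeds_at_sub sT' sT).
- by apply: leq_trans (near_without sGE xW) _; rewrite leq_add2l.
- exact: part_fan.
- by rewrite cT'.
by have := no_rainbow (sub_pairs sE) injE fQ; rewrite cQ cT' ltnn.
Qed.

Lemma injective_without cs M : {in M &, injective c} ->
  (forall e, e \in M -> c e \in cs) -> {in without cs :|: M &, injective c}.
Proof.
move=> injM Mcs e f /setUP[/setIdP[Ge ce]|Me] /setUP[/setIdP[Gf cf]|Mf].
- exact: injG.
- by move=> ef; rewrite ef Mcs in ce.
- by move=> ef; rewrite -ef Mcs in cf.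
exact: injM.
Qed.

Lemma no_seeds_G v Ts : seeds_at p G v Ts -> #|Ts| < k.+1.
Proof.
move=> sT; rewrite ltnNge; apply/negP => kT.
apply: (rainbow_seeds sG injG (without_sub set0) _ sT kT).
by rewrite cards0.
Qed.

(** The lower bound on the extremal number: the complete multipartite graph and a
complete bipartite graph inside one part. *)
Lemma cross_count : #|cross p| + k.-1 ^ 2 <= X.
Proof.
pose i := Ordinal q1.
have : k.-1 * 2 <= #|part p W i| by have := part_generic i; lia.
case/subset_of_card => B sB cB.
have : k.-1 <= #|B| by rewrite cB; lia.
case/subset_of_card => A sA cA.
have dAL : [disjoint A & B :\: A] by rewrite -setI_eq0 setDE setICA setICr setI0.
have cL : #|B :\: A| = k.-1 by rewrite cardsD (setIidPr sA) cB cA; lia.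
have pAL x : x \in A :|: (B :\: A) -> p x = i.
  have -> : A :|: (B :\: A) = B.
    by apply/eqP; rewrite eqEsubset subUset sA subsetDl -subDset subxx.
  by move=> /(subsetP sB); rewrite inE => /andP[_ /eqP].
have dcb : [disjoint cross p & bipartite_pairs A (B :\: A)].
  rewrite -setI_eq0; apply/set0Pn => -[e /setIP[+ /imsetP[[a l] /setXP[/= aA lL] De]]].
  by rewrite De in_cross !pAL ?eqxx // in_setU ?aA ?lL ?orbT.
have kk : k.-1 < k by rewrite prednK.
have := @ex_bound (cross p :|: bipartite_pairs A (B :\: A)).
rewrite cardsU (disjoint_setI0 dcb) cards0 subn0 card_bipartite_pairs // cA cL mulnn.
apply; last by apply: (@cross_bipartite_fan_free _ _ p A (B :\: A) i); rewrite ?cA ?cL.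
move=> e /setUP[/cross_pairs//|/imsetP[[a l] /setXP[/= aA lL] ->]].
rewrite cards2; case: eqP => // eal; have := disjointFr dAL aA.
by rewrite eal lL.
Qed.

Lemma inner_many : #|missed p W G| + k.-1 ^ 2 + 2 <= #|inner p G|.
Proof.
have := card_cross_split p sG; have := cross_count.
have := cardsID (pairs_in W) (cross p); have := many_colors.
by clear; lia.
Qed.

Lemma maximum_crossing E : exists F, forall i, maximum_matching (inner_in p W E i) (F i).
Proof.
by have /fin_all_exists[F FP] i := nu_ex (inner_in p W E i); exists F.
Qed.

Lemma maximum_crossing_matching E F :
  (forall i, maximum_matching (inner_in p W E i) (F i)) ->
  crossing_matching p W E F.
Proof. by move=> mF i; case/andP: (mF i) => /andP[]. Qed.

Lemma off_pair E F i e : E \subset pairs_in W -> crossing_matching p W E F ->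
  e \in union_of p q0 F -> pair_part p q0 e != i ->
  exists a b, [/\ e = [set a; b], a != b, p a = p b, p a != i & adj E a b].
Proof.
move=> sE mF; have pE := sub_pairs sE => /(union_sub pE mF) Ee nv.
have [a [b [De nab pa pb aab]]] := inner_inP pE Ee.
by exists a, b; rewrite pa pb.
Qed.

(** The ends of [k.+1] matching edges of the other parts miss few vertices of part
[i]; any other vertex of this part would be the centre of a fan. *)
Lemma off_matching_le i : \sum_(j | j != i) nu (inner_in p W G j) <= k.
Proof.
have pG := sub_pairs sG.
have [F mF] := maximum_crossing G; have cF := maximum_crossing_matching mF.
have -> : \sum_(j | j != i) nu (inner_in p W G j) = \sum_(j | j != i) #|F j|.
  by apply: eq_bigr => j _; case/andP: (mF j) => _ /eqP->.
rewrite -(card_union_off q0 i pG cF) leqNgt; apply/negP => /subfamily_of_card[M sM cM].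
have MP e : e \in M ->
    exists a b, [/\ e = [set a; b], a != b, p a = p b, p a != i & adj G a b].
  by move=> /(subsetP sM)/setIdP[Fe ni]; apply: off_pair cF Fe ni.
have MW x : x \in cover M -> x \in W.
  case/bigcupP=> e /MP[a [b [-> _ _ _ aab]]].
  by have /andP[aW bW] := adj_in sG aab; move=> /set2P[]->.
pose bad := \bigcup_(x in cover M) crossmiss p G W x.
have cbad : #|bad| <= 2 * k.+1 * m.
  apply: (@leq_trans (#|cover M| * m)).
    by apply: card_bigcup_le => x /MW; apply: miss_le.
  rewrite leq_mul2r mulnC -cM card_cover_le ?orbT // => e /MP[a [b [-> nab _ _ _]]].
  by rewrite cards2 nab.
have [v /setDP[vi vbad]] : exists v, v \in part p W i :\: bad.
  apply/set0Pn; rewrite -card_gt0 cardsD subn_gt0.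
  apply: leq_ltn_trans (part_matching i); apply: leq_trans cbad.
  exact/subset_leq_card/subsetIr.
move: vi; rewrite inE => /andP[vW /eqP pv].
have va x : x \in cover M -> p x != i -> adj G v x.
  move=> xM px; apply: contraNT vbad => nvx; apply/bigcupP; exists x => //.
  by rewrite inE vW pv eq_sym px adjC.
have [] := @build_seeds _ _ p G v set0 M.
- by move=> u; rewrite inE.
- apply: trivIsetS (union_trivIset q0 cF).
  by apply: subset_trans sM _; apply/subsetP => e /setIdP[].
- move=> e Me; have [a [b [De nab pab pai aab]]] := MP _ Me.
  have inM x : x \in e -> x \in cover M by move=> xe; apply/bigcupP; exists e.
  exists a, b; rewrite pv; split=> //; split=> //; apply: va; rewrite -?pab //.
    by rewrite inM // De set21.
  by rewrite inM // De set22.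
by move=> /no_seeds_G + e; rewrite e cards0 cM ltnn.
Qed.

Lemma inner_few : #|inner p G| <= 2 * k * k.+1.
Proof.
have pG := sub_pairs sG.
rewrite (card_inner p q0 sG).
apply: (@leq_trans (\sum_i nu (inner_in p W G i) * k.+1)).
  apply: leq_sum => i _; apply: edge_bound => [|v]; first exact: inner_in_pairs.
  have [<-|nvi] := eqVneq (p v) i.
    by rewrite -ltnS; apply: inner_degree_lt sG (@no_seeds_G v).
  by rewrite (deg_inner_in _ _ nvi).
rewrite -big_distrl /= leq_pmul2r //.
pose i := Ordinal q0; pose j := Ordinal q1.
rewrite (bigD1 i) //= mul2n -addnn; apply: leq_add; last exact: off_matching_le.
apply: leq_trans (off_matching_le j); rewrite (bigD1 i) //=; exact: leq_addr.
Qed.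

(** Almost all the vertices of a part are generic, and they can replace one
another as centres and in seeds. *)
Definition generic i := [set v in part p W i | crossmiss p G W v == set0].

Lemma generic_many i : k * (2 * k + 4) + 2 * k + 2 <= #|generic i|.
Proof.
have cD : #|part p W i :\: generic i| <= 2 * #|missed p W G|.
  rewrite -(sum_crossmiss p W G) (bigID (mem (part p W i :\: generic i))) /=.
  apply: leq_trans (leq_addr _ _); rewrite -[leqLHS]sum1_card.
  rewrite [leqRHS](eq_bigl (fun v => v \in part p W i :\: generic i)); last first.
    move=> v; rewrite in_setD [v \in part _ _ _]in_set.
    by case: (v \in W); rewrite ?andbF //= andbA.
  apply: leq_sum => v /setDP[vi]; rewrite in_set vi /= => nv.
  by rewrite card_gt0.
have gi : generic i \subset part p W i by apply/subsetP => v /setIdP[].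
have := part_generic i; rewrite -(cardsID (generic i) (part p W i)) (setIidPr gi).
have := inner_few; have := inner_many; move: cD.
by clear; lia.
Qed.

Lemma generic_adj i cs x u : x \in generic i -> x \notin touched cs ->
  u \in W -> p u != i -> adj (without cs) x u.
Proof.
rewrite in_set => /andP[/setIdP[xW /eqP px] /eqP x0] xt uW pu.
have Gxu : adj G x u.
  apply: contraT => nxu; have : u \in crossmiss p G W x by rewrite inE uW px pu.
  by rewrite x0 inE.
apply: contraNT xt => nxu; apply/bigcupP; exists [set x; u]; last exact: set21.
by rewrite in_setD nxu.
Qed.

Lemma genericW i x : x \in generic i -> (x \in W) && (p x == i).
Proof. by rewrite inE => /andP[/setIdP[-> ->]]. Qed.

Lemma generic_pair i a b : a \in generic i -> b \in generic i -> a != b ->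
  [set a; b] \in pairs_in W.
Proof.
move=> /genericW/andP[aW _] /genericW/andP[bW _] nab.
by rewrite inE cards2 nab subUset !sub1set aW bW.
Qed.

(** The bound on [Y] leaves room for [k] seeds and for the ends of two deleted
edges. *)
Definition popular i (g : C) :=
  [forall Y : {set V}, (#|Y| <= 2 * k + 4) ==>
    [exists a, exists b, [&& a \in generic i :\: Y, b \in generic i :\: Y, a != b &
       c [set a; b] == g]]].

Lemma popularP i g Y : popular i g -> #|Y| <= 2 * k + 4 ->
  exists a b, [/\ a \in generic i, b \in generic i, a \notin Y, b \notin Y &
    a != b /\ c [set a; b] = g].
Proof.
move=> /forallP/(_ Y)/implyP h /h/existsP[a /existsP[b]].
by case/and4P=> /setDP[ai aY] /setDP[bi bY] nab /eqP cab; exists a, b.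
Qed.

(** A rainbow matching of [k.+1] generic pairs of part [i] gives a rainbow fan
centred at a generic vertex of another part. So the colours of a maximum rainbow
matching are at most [k], and they are the only ones on the other generic pairs;
if each of them were destroyed by a small set [Y], so would be all of them by the
union of these sets. *)
Lemma popular_exists i : exists g, popular i g.
Proof.
pose ok M := [&& trivIset M, dinjectiveb c (mem M) &
  M \subset pairs_in (generic i)].
have okP M e : ok M -> e \in M ->
    exists a b, [/\ e = [set a; b], a != b, a \in generic i & b \in generic i].
  case/and3P=> _ _ /subsetP sM /sM; rewrite inE.
  case/andP=> /cards2P[a [b [nab ->]]]; rewrite subUset !sub1set => /andP[ai bi].
  by exists a, b.
have small M : ok M -> #|M| <= k.
  move=> okM; rewrite leqNgt; apply/negP => /subfamily_of_card[M' sM' cM'].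
  case/and3P: (okM) => tM /dinjectiveP injM _.
  have injM' : {in M' &, injective c}.
    by move=> e f /(subsetP sM') ? /(subsetP sM'); apply: injM.
  pose cs := c @: M'.
  have ccs : #|cs| = k.+1 by rewrite card_in_imset.
  have [j ji] : exists j, j != i.
    have [e|] := eqVneq (Ordinal q1) i; last by exists (Ordinal q1).
    by exists (Ordinal q0); rewrite -e.
  have [w /setDP[wj wt]] : exists w, w \in generic j :\: touched cs.
    apply/set0Pn; rewrite -card_gt0 cardsD subn_gt0.
    apply: (@leq_ltn_trans #|touched cs|); first exact/subset_leq_card/subsetIr.
    apply: leq_ltn_trans (card_touched cs) _; rewrite ccs.
    by apply: leq_trans (generic_many j); move: k0; clear; nia.
  have /andP[wW /eqP pw] := genericW wj.
  pose E := without cs :|: M'.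
  have sE : E \subset pairs_in W.
    apply/subsetP => e /setUP[/(subsetP (without_sub cs))/(subsetP sG)//|/(subsetP sM')].
    by move=> /(okP _ _ okM)[a [b [-> nab ai bi]]]; apply: generic_pair ai bi nab.
  have injE : {in E &, injective c}.
    by apply: injective_without => // e Me; apply: imset_f.
  have [] := @build_seeds _ _ p E w set0 M'.
  - by move=> u; rewrite inE.
  - exact: trivIsetS tM.
  - move=> e Me; have [a [b [De nab ai bi]]] := okP _ _ okM (subsetP sM' _ Me).
    have /andP[aW /eqP pa] := genericW ai; have /andP[bW /eqP pb] := genericW bi.
    exists a, b; rewrite pa pb pw [i == j]eq_sym; split=> //.
    split; first by rewrite /adj -De in_setU Me orbT.
      by rewrite /adj in_setU [_ \in without _](generic_adj wj wt) // pa eq_sym.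
    by rewrite /adj in_setU [_ \in without _](generic_adj wj wt) // pb eq_sym.
  move=> sT cT; apply: (rainbow_seeds sE injE (subsetUl _ _) _ sT).
    by rewrite ccs.
  by rewrite cT cards0 cM'.
have ok0 : ok set0.
  apply/and3P; split; last by rewrite sub0set.
    by apply: trivIset_intro => A B x; rewrite inE.
  by apply/dinjectiveP => e f; rewrite inE.
case: (arg_maxnP (fun M : {set {set V}} => #|M|) ok0) => M okM Mmax.
apply/existsP; apply: contraT; rewrite negb_exists => /forallP none.
have /fin_all_exists[Y YP] (g : C) : exists Y : {set V}, #|Y| <= 2 * k + 4 /\
    forall a b, a \in generic i :\: Y -> b \in generic i :\: Y -> a != b -> c [set a; b] != g.
  have := none g; rewrite negb_forall => /existsP[Y]; rewrite negb_imply.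
  case/andP=> cY /existsPn h; exists Y; split=> // a b aY bY nab.
  by have /existsPn/(_ b) := h a; rewrite aY bY nab.
pose B := cover M :|: \bigcup_(g in c @: M) Y g.
have cB : #|B| <= 2 * k + k * (2 * k + 4).
  apply: leq_trans (card_setU_le _ _) _; apply: leq_add.
    apply: leq_trans (card_cover_le (s := 2) _) _; last by rewrite mulnC leq_mul2l small.
    by move=> e /(okP _ _ okM)[a [b [-> nab _ _]]]; rewrite cards2 nab.
  apply: (@leq_trans (#|c @: M| * (2 * k + 4))).
    by apply: card_bigcup_le => g _; case: (YP g).
  rewrite leq_mul2r; apply/orP; right.
  exact: leq_trans (leq_imset_card _ _) (small _ okM).
have : 1 < #|generic i :\: B|.
  rewrite cardsD; have := subset_leq_card (subsetIr (generic i) B).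
  by have := generic_many i; move: cB; clear; lia.
case/card_gt1P=> a [b [aB bB nab]].
move: (aB) (bB); rewrite !in_setD !in_setU !negb_or.
move=> /andP[/andP[aM aY] ai] /andP[/andP[bM bY] bi].
have [/imsetP[e Me cab]|new] := boolP (c [set a; b] \in c @: M).
  have [_ /(_ a b)] := YP (c [set a; b]); rewrite !in_setD ai bi nab eqxx.
  have nY x : x \notin \bigcup_(g in c @: M) Y g -> x \notin Y (c [set a; b]).
    by apply: contra => xY; apply/bigcupP; exists (c [set a; b]); rewrite // cab imset_f.
  by rewrite !nY // => /(_ isT isT isT).
have dM : [disjoint [set a; b] & cover M].
  rewrite -setI_eq0; apply/set0Pn => -[x /setIP[/set2P[]->]].
    by rewrite (negPf aM).
  by rewrite (negPf bM).
have okM' : ok ([set a; b] |: M).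
  case/and3P: okM => tM /dinjectiveP injM sM; apply/and3P; split.
  - exact: trivIset_add.
  - apply/dinjectiveP => e f /setU1P[->|Me] /setU1P[->|Mf] // ef.
    + by move: new; rewrite ef imset_f.
    + by move: new; rewrite -ef imset_f.
    exact: injM.
  - by rewrite subUset sM andbT sub1set inE cards2 nab subUset !sub1set ai bi.
have := Mmax _ okM'; rewrite /geq /= (card_add (set21 a b) dM).
by rewrite ltnn.
Qed.

(** A generic pair of colour [g] in part [i] is one more seed at [v], and its
colour is not used by the graph without the colours of [cs]. *)
Lemma popular_seed cs g i v Ts : g \in cs -> #|cs| <= 2 -> popular i g ->
  i != p v -> seeds_at p (without cs) v Ts -> #|Ts| < k.
Proof.
move=> gcs ccs pop iv sT; rewrite ltnNge; apply/negP => /subfamily_of_card[Ts' sT' cT'].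
have {}sT := seeds_at_sub sT' sT; have [tT sd] := sT.
have sW : without cs \subset pairs_in W := subset_trans (without_sub cs) sG.
have /card_gt0P[T0 T0T] : 0 < #|Ts'| by rewrite cT'.
have vW : v \in W.
  by apply: (subsetP (seed_center sW (sd _ T0T))); rewrite setU11.
have cY : #|touched cs :|: cover Ts'| <= 2 * k + 4.
  apply: leq_trans (card_setU_le _ _) _; rewrite addnC; apply: leq_add.
    apply: leq_trans (card_cover_le (s := 2) _) _; last by rewrite cT' mulnC.
    by move=> T /sd/seed_card_le.
  by apply: leq_trans (card_touched cs) _; rewrite -[4]/(2 * 2) leq_mul2r ccs orbT.
have [a [b [ai bi]]] := popularP pop cY.
rewrite !in_setU !negb_or => /andP[at' aT] /andP[bt bT] [nab cab].
have /andP[aW /eqP pa] := genericW ai; have /andP[bW /eqP pb] := genericW bi.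
pose E := without cs :|: [set [set a; b]].
have sE : E \subset pairs_in W.
  by rewrite subUset sW sub1set (generic_pair ai bi nab).
have injE : {in E &, injective c}.
  apply: injective_without => [e f /set1P-> /set1P->//|e /set1P->].
  by rewrite cab.
have dT : [disjoint [set a; b] & cover Ts'].
  rewrite -setI_eq0; apply/set0Pn => -[x /setIP[/set2P[]->]].
    by rewrite (negPf aT).
  by rewrite (negPf bT).
have av : adj E a v.
  by rewrite /adj in_setU [_ \in without _](generic_adj ai at' vW) // eq_sym.
have bv : adj E b v.
  by rewrite /adj in_setU [_ \in without _](generic_adj bi bt vW) // eq_sym.
have aab : adj E a b by rewrite /adj in_setU in_set1 eqxx orbT.
have sTE : seeds_at p E v ([set a; b] |: Ts').
  split; first exact: trivIset_add.
  move=> T /setU1P[->|/sd[cl sh]]; last first.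
    by split=> //; apply: clique_inS cl; apply: subsetUl.
  split; last by right; exists a, b; rewrite pa pb.
  by move=> x y /setU1P[->|/set2P[->|->]] /setU1P[->|/set2P[->|->]] nxy;
    rewrite ?eqxx // in nxy *; rewrite adjC.
apply: (rainbow_seeds sE injE (subsetUl _ _) _ sTE).
  by apply: leq_trans ccs _; rewrite ltnS.
by rewrite (card_add (set21 a b) dT) cT'.
Qed.

(** If two parts shared a popular colour [g], one of them would not be the part of
the centre, whatever the centre: the graph without this colour would have no fan
with [k] cliques. This remains true with all the cross pairs at the vertices off
[W], because the seeds stay in [W] and a centre off [W] can be replaced by a
generic vertex. The result has too many edges. *)
Lemma popular_distinct i j g : i != j -> popular i g -> ~~ popular j g.
Proof.
move=> nij pi; apply/negP => pj; pose cs := [set g].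
have sW : without cs \subset pairs_in W := subset_trans (without_sub cs) sG.
have ns v Ts : seeds_at p (without cs) v Ts -> #|Ts| < k.
  have [iv|iv] := eqVneq i (p v).
    apply: (@popular_seed _ g j) => //; rewrite ?set11 ?cards1 //.
    by rewrite -iv eq_sym.
  by apply: (@popular_seed _ g i) => //; rewrite ?set11 ?cards1.
pose H := without cs :|: (cross p :\: pairs_in W).
have pH : is_pairs H.
  by move=> e /setUP[/(sub_pairs sW)//|/setDP[/cross_pairs]].
have inW x y : adj H x y -> x \in W -> y \in W -> adj (without cs) x y.
  move=> /setUP[//|/setDP[Cxy]]; rewrite inE (cross_pairs Cxy) eqxx /=.
  by rewrite subUset !sub1set => nxy xW yW; rewrite xW yW in nxy.
have inner_adj x y : adj H x y -> p x = p y -> adj (without cs) x y.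
  by move=> /setUP[//|/setDP[+ _]] pxy; rewrite in_cross pxy eqxx.
have fH : fan_free H q k.
  move=> v Q fQ; rewrite ltnNge; apply/negP => kQ.
  have [Ts [[tT sd] cT]] := fan_seeds p fQ.
  have seedH T : T \in Ts -> forall w, p w = p v -> w \in W ->
      (v \in W -> w = v) -> (v \notin W -> w \in generic (p v) :\: touched cs) ->
      seed p (without cs) w T.
    move=> TT w pw wW wv1 wv2; have [cl sh] := sd _ TT.
    case: sh cl => [[u [-> nuv puv]] cl|[a [b [-> nab pab pav]]] cl].
      have avu : adj (without cs) v u.
        by apply: inner_adj => //; apply: cl; rewrite ?inE ?eqxx ?orbT // eq_sym.
      have /andP[vW uW] := adj_in sW avu; rewrite (wv1 vW).
      split; last by left; exists u.
      move=> x y /setU1P[->|/set1P->] /setU1P[->|/set1P->] nxy; rewrite ?eqxx // in nxy *.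
      by rewrite adjC.
    have aab : adj (without cs) a b.
      by apply: inner_adj => //; apply: cl; rewrite ?inE ?eqxx ?orbT.
    have /andP[aW bW] := adj_in sW aab.
    have wx x : x \in [set a; b] -> adj (without cs) w x.
      move=> xab; have px : p x = p a by case/set2P: xab => ->.
      have xW : x \in W by case/set2P: xab => ->.
      have [vW|vW] := boolP (v \in W).
        have nvx : v != x by apply: contraNneq pav => ->; rewrite px.
        rewrite (wv1 vW); apply: inW => //.
        exact: (cl v x (setU11 _ _) (setU1r _ xab) nvx).
      have /setDP[wg wt] := wv2 vW.
      by apply: generic_adj wg wt xW _; rewrite px.
    split; last by right; exists a, b; rewrite pw.
    move=> x y /setU1P[->|xab] /setU1P[->|yab] nxy.
    - by rewrite eqxx in nxy.
    - exact: wx.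
    - by rewrite adjC wx.
    by case/set2P: xab nxy => ->; case/set2P: yab => ->; rewrite ?eqxx // adjC.
  have [vW|vW] := boolP (v \in W).
    have /ns : seeds_at p (without cs) v Ts.
      by split=> // T TT; apply: seedH => //; rewrite vW.
    by rewrite cT ltnNge kQ.
  have [w /[dup] wD /setDP[wg wt]] : exists w, w \in generic (p v) :\: touched cs.
    apply/set0Pn; rewrite -card_gt0 cardsD subn_gt0.
    apply: (@leq_ltn_trans #|touched cs|); first exact/subset_leq_card/subsetIr.
    apply: leq_ltn_trans (card_touched cs) _; rewrite cards1.
    by apply: leq_trans (generic_many (p v)); move: k0; clear; nia.
  have /andP[wW /eqP pw] := genericW wg.
  have /ns : seeds_at p (without cs) w Ts.
    by split=> // T TT; apply: seedH => // vW'; rewrite vW' in vW.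
  by rewrite cT ltnNge kQ.
have := ex_bound pH fH; rewrite cardsU (_ : _ :&: _ = set0) ?cards0 ?subn0.
  have := card_removed cs; rewrite cards1 cardsD (setIidPr (without_sub cs)).
  rewrite leq_subLR => le1 le2.
  have := leq_trans many_colors (leq_add le1 (leqnn _)).
  by rewrite addnAC => /leq_trans/(_ (leq_add le2 (leqnn 1))); rewrite leq_add2l.
apply/setP => e; rewrite in_setI in_setD in_set0.
by apply/negP => /andP[/(subsetP sW)->].
Qed.

(** Generic centres are joined to all the candidate seeds of the other parts, so
that only the number of the seeds matters. *)
Lemma generic_center cs E i w (S : {set V}) M : #|cs| <= 2 -> without cs \subset E ->
  E \subset pairs_in W -> {in E &, injective c} ->
  w \in generic i -> w \notin touched cs ->
  (forall u, u \in S -> [/\ u != w, p u = i & adj E w u]) -> trivIset M ->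
  (forall e, e \in M -> exists a b,
     [/\ e = [set a; b], a != b, p a = p b, p a != i & adj E a b]) ->
  #|S| + #|M| <= k.
Proof.
move=> ccs sHE sE injE wi wt Sw tM MP.
have /andP[wW /eqP pw] := genericW wi.
have wx x : x \in W -> p x != i -> adj E w x.
  by move=> xW px; apply: (subsetP sHE); apply: generic_adj wi wt xW px.
have [u /Sw[uw pu wu]||e Me|sT cT] := @build_seeds _ _ p E w S M.
- by rewrite pw.
- exact: tM.
- have [a [b [De nab pab pai aab]]] := MP _ Me.
  have /andP[aW bW] := adj_in sE aab.
  by exists a, b; rewrite pw; split=> //; split=> //; apply: wx; rewrite -?pab.
rewrite leqNgt; apply/negP => kSM; apply: (rainbow_seeds sE injE sHE _ sT).
  by apply: leq_trans ccs _; rewrite ltnS.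
by rewrite cT.
Qed.

Section TwoColors.
Variables (i1 i2 : 'I_q) (g1 g2 : C).
Hypotheses (i12 : i1 != i2) (g12 : g1 != g2).
Hypotheses (pop1 : popular i1 g1) (pop2 : popular i2 g2).
Variable F : 'I_q -> {set {set V}}.
Hypothesis cF : crossing_matching p W (without [set g1; g2]) F.

Let cs := [set g1; g2].
Let cs2 : #|cs| <= 2. Proof. by rewrite cards2 g12. Qed.

Let sH : without cs \subset pairs_in W.
Proof. exact: subset_trans (without_sub cs) sG. Qed.

Lemma no_seeds_two v Ts : seeds_at p (without cs) v Ts -> #|Ts| < k.
Proof.
have [iv|iv] := eqVneq i1 (p v).
  apply: (@popular_seed _ g2 i2) => //; rewrite ?set22 //.
  by rewrite -iv eq_sym.
by apply: (@popular_seed _ g1 i1) => //; rewrite ?set21.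
Qed.

(** The common part of the next two lemmas: generic pairs of both popular colours
are added to the graph, off a matching [M] of [k.-1] edges in the other parts
than [i]. *)
Lemma two_popular_pairs i : k <= (\sum_(j | j != i) #|F j|).+1 ->
  exists M a b a' b', let E := without cs :|: [set [set a; b]; [set a'; b']] in
    [/\ [/\ trivIset M, #|M| = k.-1, [disjoint [set a; b] & cover M] &
            [disjoint [set a'; b'] & cover M]],
        forall e, e \in M -> exists a b,
          [/\ e = [set a; b], a != b, p a = p b, p a != i & adj E a b],
        [/\ a != b, a \in generic i1, b \in generic i1, a \notin touched cs &
            b \notin touched cs],
        [/\ a' != b', a' \in generic i2, b' \in generic i2 & a' \notin touched cs] &
        [/\ E \subset pairs_in W, {in E &, injective c}, without cs \subset E,
            adj E a b & adj E a' b']].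
Proof.
have pH := sub_pairs sH.
rewrite -(card_union_off q0 i pH cF) => kF.
have /subfamily_of_card[M sM cM] :
    k.-1 <= #|[set e in union_of p q0 F | pair_part p q0 e != i]|.
  by rewrite -ltnS prednK.
have MP e : e \in M ->
    exists a b, [/\ e = [set a; b], a != b, p a = p b, p a != i & adj (without cs) a b].
  by move=> /(subsetP sM)/setIdP[Fe ni]; apply: off_pair cF Fe ni.
have tM : trivIset M.
  apply: trivIsetS (union_trivIset q0 cF).
  by apply: subset_trans sM _; apply/subsetP => e /setIdP[].
have cY : #|touched cs :|: cover M| <= 2 * k + 4.
  apply: leq_trans (card_setU_le _ _) _; rewrite addnC; apply: leq_add.
    apply: leq_trans (card_cover_le (s := 2) _) _.
      by move=> e /MP[a [b [-> nab _ _ _]]]; rewrite cards2 nab.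
    by rewrite cM mulnC leq_mul2l leq_pred.
  by apply: leq_trans (card_touched cs) _; rewrite -[4]/(2 * 2) leq_mul2r cs2 orbT.
have [a [b [ai bi]]] := popularP pop1 cY.
rewrite !in_setU !negb_or => /andP[ta Ma] /andP[tb Mb] [nab cab].
have [a' [b' [ai' bi']]] := popularP pop2 cY.
rewrite !in_setU !negb_or => /andP[ta' Ma'] /andP[tb' Mb'] [nab' cab'].
have disj x y : x \notin cover M -> y \notin cover M -> [disjoint [set x; y] & cover M].
  move=> xM yM; rewrite -setI_eq0; apply/set0Pn => -[z /setIP[/set2P[]->]].
    by rewrite (negPf xM).
  by rewrite (negPf yM).
exists M, a, b, a', b'; split=> //.
- by split=> //; apply: disj.
- move=> e /MP[x [y [De nxy pxy pxi axy]]]; exists x, y; split=> //.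
  by rewrite /adj in_setU [_ \in without _]axy.
split; rewrite ?subsetUl //.
- rewrite !subUset sH !sub1set (generic_pair ai bi nab).
  by rewrite (generic_pair ai' bi' nab').
- apply: injective_without => [e f|e].
    by move=> /set2P[->|->] /set2P[->|->] //; rewrite cab cab' => /eqP;
      rewrite ?(negPf g12) // eq_sym (negPf g12).
  by move=> /set2P[->|->]; rewrite ?cab ?cab' !inE eqxx ?orbT.
- by rewrite /adj in_setU set21 orbT.
by rewrite /adj in_setU set22 orbT.
Qed.

(** In part [i1], the pair of colour [g1] is a star at one of its ends, the centre,
and the pair of colour [g2] joins the matching. *)
Lemma off_matching_first : \sum_(j | j != i1) #|F j| + 2 <= k.
Proof.
rewrite leqNgt addn2 !ltnS; apply/negP => /two_popular_pairs.
case=> M [a [b [a' [b' [[tM cM dM dM'] MP [nab ai bi ta _] [nab' ai' bi' _]]]]]].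
case=> sE injE sHE aab aab'.
have /andP[_ /eqP pa'] := genericW ai'; have /andP[_ /eqP pb'] := genericW bi'.
have /andP[_ /eqP pb] := genericW bi.
have := @generic_center cs _ i1 a [set b] ([set a'; b'] |: M) cs2 sHE sE injE ai ta.
rewrite cards1 (card_add (set21 a' b') dM') cM prednK // add1n ltnn => h.
suff : false by []; apply: h.
- by move=> u /set1P->; rewrite eq_sym.
- exact: trivIset_add.
move=> e /setU1P[->|/MP//]; exists a', b'; rewrite pa' pb'.
by split=> //; rewrite eq_sym.
Qed.

(** For a centre in a third part, both pairs join the matching. *)
Lemma off_matching_third i : i != i1 -> i != i2 ->
  \sum_(j | j != i) #|F j| + 2 <= k.
Proof.
move=> ni1 ni2; rewrite leqNgt addn2 !ltnS; apply/negP => /two_popular_pairs.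
case=> M [a [b [a' [b' [[tM cM dM dM'] MP [nab ai bi ta _] [nab' ai' bi' _]]]]]].
case=> sE injE sHE aab aab'.
have /andP[_ /eqP pa'] := genericW ai'; have /andP[_ /eqP pb'] := genericW bi'.
have /andP[_ /eqP pa] := genericW ai; have /andP[_ /eqP pb] := genericW bi.
have [w /setDP[wi wt]] : exists w, w \in generic i :\: touched cs.
  apply/set0Pn; rewrite -card_gt0 cardsD subn_gt0.
  apply: (@leq_ltn_trans #|touched cs|); first exact/subset_leq_card/subsetIr.
  apply: leq_ltn_trans (card_touched cs) _.
  apply: (@leq_ltn_trans (2 * 2)); first by rewrite leq_mul2r cs2 orbT.
  by apply: leq_trans (generic_many i); move: k0; clear; nia.
have dN : [disjoint [set a; b] & cover ([set a'; b'] |: M)].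
  rewrite -setI_eq0; apply/set0Pn => -[x /setIP[xab /bigcupP[e /setU1P[->|Me] xe]]].
    have : p x = i1 by case/set2P: xab => ->.
    have -> : p x = i2 by case/set2P: xe => ->.
    by move/eqP; rewrite eq_sym (negPf i12).
  have := disjointFr dM xab; have -> // : x \in cover M.
  by apply/bigcupP; exists e.
have := @generic_center cs _ i w set0 ([set a; b] |: ([set a'; b'] |: M)) cs2 sHE sE injE wi wt.
rewrite cards0 (card_add (set21 a b) dN) (card_add (set21 a' b') dM') cM prednK //.
rewrite add0n ltnn => h; suff : false by []; apply: h.
- by move=> u; rewrite inE.
- by apply: trivIset_add => //; apply: trivIset_add.
move=> e /setU1P[->|/setU1P[->|/MP//]].
  by exists a, b; rewrite pa pb; split=> //; rewrite eq_sym.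
by exists a', b'; rewrite pa' pb'; split=> //; rewrite eq_sym.
Qed.

End TwoColors.

Lemma off_matching_two i1 i2 g1 g2 F i : i1 != i2 -> g1 != g2 ->
  popular i1 g1 -> popular i2 g2 ->
  crossing_matching p W (without [set g1; g2]) F ->
  \sum_(j | j != i) #|F j| + 2 <= k.
Proof.
move=> i12 g12 pop1 pop2 cF.
have [->|ni1] := eqVneq i i1; first exact: off_matching_first i12 g12 pop1 pop2 _ cF.
have [->|ni2] := eqVneq i i2; last exact: off_matching_third i12 g12 pop1 pop2 _ cF _ ni1 ni2.
by rewrite setUC in cF; apply: off_matching_first pop2 pop1 _ cF; rewrite eq_sym.
Qed.

Lemma final_count (x g h d cr iH mH K S : nat) : x + 2 <= g + d -> g - h <= 2 ->
  cr + d + K <= x -> h + mH = iH + cr -> 2 * iH <= S + 2 * mH -> 2 * K <= S.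
Proof. by lia. Qed.

(** The graph [H] without two popular colours has no fan with [k] cliques, and
it has at least [#|missed p W H| + k.-1 ^ 2] inner edges. The inner degree of [v]
is at most [k.-1], and at most the bound of [matching_weights] plus the number of
pairs missed by [v]; half the sum of the latter is the number of missed pairs,
so that they cancel out. *)
Theorem too_many_colors : False.
Proof.
pose i1 := Ordinal q0; pose i2 := Ordinal q1.
have i12 : i1 != i2 by [].
have [g1 pop1] := popular_exists i1; have [g2 pop2] := popular_exists i2.
have g12 : g1 != g2.
  by apply: contraTneq pop2 => <-; apply: popular_distinct i12 pop1.
pose cs := [set g1; g2]; pose H := without cs.
have sH : H \subset pairs_in W := subset_trans (without_sub cs) sG.
have pH := sub_pairs sH.
have [F mF] := maximum_crossing H; have cF := maximum_crossing_matching mF.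
have nuF i : nu (inner_in p W H i) = #|F i| by case/andP: (mF i) => _ /eqP->.
have ns v Ts : seeds_at p H v Ts -> #|Ts| < k.
  exact: (@no_seeds_two i1 i2 g1 g2 i12 g12 pop1 pop2 v Ts).
have off i : \sum_(j | j != i) #|F j| + 2 <= k := off_matching_two i i12 g12 pop1 pop2 cF.
have [w [w1 w2]] := matching_weights q1 off.
rewrite ltnNge => /negP[].
pose cm i v := if v \in part p W i then #|crossmiss p H W v| else 0.
have bound i : 2 * #|inner_in p W H i| <= #|F i| * w i + \sum_v cm i v.
  rewrite -nuF; apply: (weighted_edge_bound _ _ _ (w1 i) (w2 i)).
  - exact: inner_in_pairs.
  - move=> v; have [<-|nvi] := eqVneq (p v) i; last by rewrite (deg_inner_in _ _ nvi).
    by rewrite -ltnS prednK //; apply: inner_degree_lt sH (@ns v).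
  move=> v; have [pv|nvi] := eqVneq (p v) i; last by rewrite (deg_inner_in _ _ nvi).
  rewrite /cm inE pv eqxx andbT; have [vW|vW] := boolP (v \in W).
    have := degree_plus_matching q0 sH (@ns v) cF; rewrite pv.
    move: (deg _ _) (crossmiss _ _ _ _) (off i) k0 => dg cmv.
    by move: (\sum_(j | j != i) _) #|cmv|; clear; lia.
  suff -> : deg (inner_in p W H i) v = 0 by [].
  apply/eqP; rewrite cards_eq0; apply/eqP/setP => e; rewrite !inE.
  apply/negP => /andP[/andP[_ /subsetP si] /si]; rewrite inE.
  by rewrite (negPf vW).
have le1 : 2 * #|inner p H| <= \sum_i #|F i| * w i + 2 * #|missed p W H|.
  rewrite (card_inner p q0 sH) big_distrr /= -sum_crossmiss.
  have -> : \sum_(v in W) #|crossmiss p H W v| = \sum_i \sum_v cm i v.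
    rewrite exchange_big [LHS]big_mkcond /=; apply: eq_bigr => v _.
    rewrite (bigD1 (p v)) //= /cm inE eqxx andbT [X in _ + X]big1 ?addn0 //.
    by move=> i ni; rewrite inE eq_sym (negPf ni) andbF.
  by rewrite -big_split /=; apply: leq_sum => i _; apply: bound.
apply: final_count many_colors _ _ (card_cross_split p sH) le1.
  by have := card_removed cs; rewrite cardsD (setIidPr (without_sub cs)) cards2 g12.
by rewrite cardsID cross_count.
Qed.

End Coloring.

(** * Reduction to large colour degrees *)

(** All the sizes needed are at most a small multiple of [T]; the lower bound on
[d], which will be about the size of a part, is [16 * (q + 1) ^ 4 * T]. *)
Section Sizes.
Variables (k q d : nat).
Hypotheses (k0 : 0 < k) (q1 : 1 < q).
Hypothesis big_d : 16 * (k + 1) ^ 2 * (q + 1) ^ 7 <= d.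

Let T := (k + 1) ^ 2 * (q + 1) ^ 3.
Let m := (q + 2) * (3 * k * q + 2 * q) + k * q.

Lemma size_T : 1000 * T <= d.
Proof.
apply: leq_trans big_d.
have -> : 16 * (k + 1) ^ 2 * (q + 1) ^ 7 = 16 * (q + 1) ^ 4 * T.
  by rewrite /T (expnD _ 4 3); move: ((q + 1) ^ 4) ((q + 1) ^ 3) ((k + 1) ^ 2); clear; nia.
rewrite leq_mul2r; apply/orP; right.
apply: (@leq_trans (16 * 3 ^ 4)) => //.
by rewrite leq_mul2l leq_exp2r //= addn1 ltnS.
Qed.

Let KT : (k + 1) ^ 2 <= T.
Proof. by rewrite /T leq_pmulr // expn_gt0 addn1. Qed.

Lemma size_slack : 3 * k * q + 2 * q <= 5 * T.
Proof.
apply: (@leq_trans (5 * ((k + 1) * (q + 1)))); first by clear; nia.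
rewrite leq_mul2l /T; apply: leq_mul; first by rewrite -{1}[k + 1]expn1 leq_pexp2l // addn1.
by rewrite -{1}[q + 1]expn1 leq_pexp2l // addn1.
Qed.

Lemma size_miss : m <= 8 * ((k + 1) * (q + 1) ^ 2).
Proof. by rewrite /m -mulnn; move: k0 q1; clear; nia. Qed.

Lemma size_fan : (q + 1) * (m + k.+1) + (k.+1 * (q + 2) + 1) <= 12 * T.
Proof.
apply: (@leq_trans (12 * ((k + 1) * (q + 1) ^ 3))); last first.
  rewrite leq_mul2l /T leq_mul2r; apply/orP; right; apply/orP; right.
  by rewrite -{1}[k + 1]expn1 leq_pexp2l // addn1.
have h1 : (q + 1) * m <= 8 * ((k + 1) * (q + 1) ^ 3).
  rewrite (expnSr _ 2) mulnA mulnA mulnC leq_mul2r; apply/orP; right.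
  by rewrite -mulnA size_miss.
rewrite mulnDr; have : (q + 1) * k.+1 + (k.+1 * (q + 2) + 1) <= 4 * ((k + 1) * (q + 1) ^ 3).
  apply: (@leq_trans (4 * ((k + 1) * (q + 1)))); first by move: k0 q1; clear; nia.
  rewrite !leq_mul2l; apply/orP; right; apply/orP; right.
  by rewrite -{1}[q + 1]expn1 leq_pexp2l // addn1.
by move: ((q + 1) ^ 3) h1 => X; move: (_ * m) => Y; clear; lia.
Qed.

Lemma size_generic : k * (2 * k + 4) + 2 * k + 2 + 4 * k * k.+1 <= 8 * T.
Proof.
apply: (@leq_trans (8 * (k + 1) ^ 2)); last by rewrite leq_mul2l KT.
by rewrite -mulnn; clear; nia.
Qed.

Lemma size_matching : 2 * k.+1 * m <= 16 * T.
Proof.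
apply: (@leq_trans (2 * k.+1 * (8 * ((k + 1) * (q + 1) ^ 2)))).
  by rewrite leq_mul2l size_miss orbT.
have -> : 2 * k.+1 * (8 * ((k + 1) * (q + 1) ^ 2)) = 16 * ((k + 1) ^ 2 * (q + 1) ^ 2).
  by rewrite -[(k + 1) ^ 2]mulnn; move: ((q + 1) ^ 2); clear; nia.
by rewrite leq_mul2l /T leq_mul2l leq_pexp2l ?orbT // addn1.
Qed.

Lemma size_partition : q + k * q * q <= d.
Proof.
apply: leq_trans size_T; apply: (@leq_trans (1000 * ((k + 1) ^ 2 * (q + 1) ^ 2))).
  apply: (@leq_trans ((k + 1) * (q + 1) ^ 2)); first by rewrite -mulnn; clear; nia.
  apply: (@leq_trans ((k + 1) ^ 2 * (q + 1) ^ 2)); last by rewrite leq_pmull.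
  by rewrite leq_mul2r; apply/orP; right; rewrite -{1}[k + 1]expn1 leq_pexp2l // addn1.
by rewrite leq_mul2l /T leq_mul2l leq_pexp2l ?orbT // addn1.
Qed.

Lemma T_gt0 : 0 < T.
Proof. by rewrite muln_gt0 !expn_gt0 !addn1. Qed.

End Sizes.

Lemma representatives (S C : finType) (A : {set S}) (f : S -> C) :
  exists G : {set S}, [/\ G \subset A, {in G &, injective f} & f @: G = f @: A].
Proof.
pose rep g := [pick e in A | f e == g].
exists [set e in A | rep (f e) == Some e]; split.
- by apply/subsetP => e; rewrite inE => /andP[].
- move=> e e'; rewrite !inE => /andP[_ /eqP re] /andP[_ /eqP re'] ef.
  by apply: Some_inj; rewrite -re -re' ef.
apply/setP => g; apply/imsetP/imsetP => -[e]; first by rewrite inE => /andP[Ae _]; exists e.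
move=> Ae ->.
have [e' [re Ae' fe']] : exists e', [/\ rep (f e) = Some e', e' \in A & f e' = f e].
  rewrite /rep; case: pickP => [x /andP[Ax /eqP fx]|/(_ e)]; first by exists x.
  by rewrite Ae eqxx.
by exists e'; rewrite // inE Ae' fe' re eqxx.
Qed.

Section ManyParts.
Variables (V C : finType) (c : {set V} -> C) (q k X : nat).
Hypotheses (q1 : 1 < q) (k0 : 0 < k).
Hypothesis no_rainbow : forall E : {set {set V}},
  is_pairs E -> {in E &, injective c} -> fan_free E q k.+1.
Hypothesis ex_bound : forall H : {set {set V}},
  is_pairs H -> fan_free H q k -> #|H| <= X.
Hypothesis large : 256 * (k + 1) ^ 5 * (q + 1) ^ 16 <= #|V|.

Let q0 : 0 < q := ltnW q1.

Definition colors (W : {set V}) := #|c @: pairs_in W|.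

(** The difference between the sizes of the Turan graphs with [q] parts of the
orders [#|V|] and [w]. *)
Definition turan_gain w := \sum_(w <= j < #|V|) (j - j %/ q).

Lemma turan_gain_le : turan_gain 0 <= X.
Proof.
have [p' [_]] := part_extend (fun=> Ordinal q0) (set0 : {set V}) q0.
rewrite cards0 => h; apply: leq_trans h _.
apply: (@leq_trans #|cross p'|); first exact/subset_leq_card/subsetDl.
have dAL : [disjoint (set0 : {set V}) & (set0 : {set V})] by rewrite -setI_eq0 setI0.
apply: ex_bound; first exact: cross_pairs.
have := @cross_bipartite_fan_free _ _ p' set0 set0 (Ordinal q0) k dAL.
rewrite !cards0 => /(_ _ k0 k0) h0.
apply: fan_freeS (subsetUl _ _) (h0 _) => x.
by rewrite setU0 inE.
Qed.

(** Remove one by one the vertices whose deletion loses fewer colours than a Turan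
graph loses edges. Each step gains one colour on the Turan numbers, but [W]
carries at most [#|W| * #|W|.-1] colours, which bounds the number of steps. *)
Lemma large_core : X + 2 <= colors setT ->
  exists W, [/\ X + 2 <= colors W + turan_gain #|W|, #|V| <= #|W| ^ 2 &
    forall v, v \in W -> colors (W :\ v) + (#|W|.-1 - #|W|.-1 %/ q) <= colors W].
Proof.
move=> cT; pose P (W : {set V}) := X + 2 + (#|V| - #|W|) <= colors W + turan_gain #|W|.
have PT : P setT by rewrite /P cardsT subnn addn0 (leq_trans cT) // leq_addr.
case: (arg_minnP (fun W : {set V} => #|W|) PT) => W PW minW.
exists W; split; first exact: leq_trans (leq_addr _ _) PW.
  have c1 : colors W <= #|W| * #|W|.-1.
    apply: leq_trans (leq_imset_card _ _) _.
    by rewrite -card_all_pairs leq_pmull.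
  have g1 : turan_gain #|W| <= X.
    apply: leq_trans turan_gain_le; rewrite /turan_gain.
    by rewrite [leqRHS](big_cat_nat (n := #|W|)) //= ?max_card // leq_addl.
  have wn := max_card (mem W); move: PW; rewrite /P -mulnn.
  move: (colors W) (turan_gain #|W|) c1 g1 wn => cw g; move: #|W| #|V| => w n.
  by clear; case: w => [|w] /=; nia.
move=> v vW; rewrite leqNgt; apply/negP => lt.
have cWv : #|W| = #|W :\ v|.+1 by rewrite (cardsD1 v) vW.
have : P (W :\ v).
  have wn := max_card (mem W); move: PW lt; rewrite /P /turan_gain.
  rewrite (big_ltn (m := #|W :\ v|)); last by rewrite -cWv.
  rewrite -cWv; have -> : #|W :\ v| = #|W|.-1 by rewrite cWv.
  move: (\sum_(_ <= _ < _) _) (colors W) (colors _) wn (_ - _ %/ q) => g a b.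
  have : 0 < #|W| by rewrite cWv.
  move: #|W| #|V| => w n; clear; lia.
by move/minW; rewrite /= cWv ltnn.
Qed.

(** By minimality of the core, one edge of each colour of the core makes a graph with
the minimum degree of a Turan graph, to which [near_partition] applies. *)
Theorem colors_bound : colors setT <= X + 1.
Proof.
rewrite leqNgt -addnS; apply/negP => /large_core[W [PW nW loss]].
have [G [sG injG cG]] := representatives (pairs_in W) c.
have pG : is_pairs G := sub_pairs sG.
have GW : #|G| = colors W by rewrite /colors -cG card_in_imset.
pose w := #|W|; pose d := (w.-1 %/ q).+1.
have big_w : 16 * (k + 1) ^ 2 * (q + 1) ^ 8 <= w.
  rewrite -(@leq_exp2r _ _ 2) //; apply: leq_trans nW; apply: leq_trans large.
  rewrite 2!expnMn -(expnM (k + 1)) -(expnM (q + 1)) leq_mul2r; apply/orP; right.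
  by rewrite leq_mul2l leq_pexp2l // addn1.
have w0 : 0 < w.
  by apply: leq_trans big_w; rewrite 2!muln_gt0 !expn_gt0 !addn1.
have qd : q * d < w + q.
  rewrite /d mulnS [q * _]mulnC addnC ltn_add2r.
  by apply: leq_ltn_trans (leq_trunc_div _ _) _; rewrite prednK.
have wd : w <= q * d by have := ltn_ceil w.-1 q0; rewrite prednK // mulnC.
have big_d : 16 * (k + 1) ^ 2 * (q + 1) ^ 7 <= d.
  rewrite -(leq_pmul2l q0); apply: leq_trans wd; apply: leq_trans big_w.
  rewrite (expnSr _ 7) mulnC mulnA leq_mul2l leq_addr orbT //.
have degG v : v \in W -> #|W :\: nbr G v| <= d.
  move=> vW; have cGv : #|[set e in G | v \notin e]| <= colors (W :\ v).
    rewrite -(card_in_imset (f := c)); last first.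
      by move=> e f; rewrite !inE => /andP[Ge _] /andP[Gf _]; apply: injG.
    apply/subset_leq_card/imsetS/subsetP => e; rewrite inE => /andP[Ge ve].
    have := subsetP sG _ Ge; rewrite !inE => /andP[-> /= sW].
    by rewrite subsetD1 sW.
  have cGd : #|G| = deg G v + #|[set e in G | v \notin e]|.
    rewrite -(cardsID [set e : {set V} | v \in e] G); congr (_ + _).
      by apply: eq_card => e; rewrite !inE.
    by apply: eq_card => e; rewrite !inE andbC.
  have nW' : nbr G v \subset W.
    by apply/subsetP => u; rewrite inE => /(adj_in sG)/andP[].
  rewrite cardsD (setIidPr nW') -deg_nbr //.
  have := loss v vW; rewrite -GW cGd -/w /d; move: cGv.
  move: (deg G v) (colors _) #|[set e in G | _]| (w.-1 %/ q) => a b e x.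
  by clear -w0; lia.
have [p0 [miss big]] := near_partition q1 sG (no_rainbow pG injG) degG qd
                          (size_partition q1 big_d).
have [p [pp0 gain]] := part_extend p0 W q0.
have pW u : u \in W -> p u = p0 u by apply: pp0.
have partE i : part p W i = part p0 W i.
  by apply/setP => u; rewrite !inE; case: (boolP (u \in W)) => // /pW->.
have missE v : v \in W -> crossmiss p G W v = crossmiss p0 G W v.
  move=> vW; apply/setP => u; rewrite !inE (pW v vW).
  by case: (boolP (u \in W)) => // /pW->.
have slack i x : x <= 16 * ((k + 1) ^ 2 * (q + 1) ^ 3) -> x < #|part p W i|.
  move=> xT; have := big i; have := size_slack k q.
  have := size_T q1 big_d; have := T_gt0 k q; move: xT.
  rewrite partE; move: (_ * (q + 1) ^ 3) #|part p0 W i| (3 * k * q + 2 * q).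
  by move: (d) => e a b h; clear; lia.
apply: (@too_many_colors V C c q k X q1 k0 no_rainbow ex_bound W G p
          ((q + 2) * (3 * k * q + 2 * q) + k * q) sG injG).
- by move=> v vW; rewrite missE // miss.
- by rewrite GW; apply: leq_trans PW _; rewrite leq_add2l; exact: gain.
- move=> i; apply: slack; apply: leq_trans (size_fan k0 q1) _.
  by rewrite leq_mul2r orbT.
- move=> i; apply/ltnW/slack; apply: leq_trans (size_generic k q) _.
  by rewrite leq_mul2r orbT.
by move=> i; apply: slack; apply: leq_trans (size_matching k0 q1) _.
Qed.

End ManyParts.

(** * Colourings without a rainbow star *)

Section Stars.
Variable V : finType.
Implicit Types (E H : {set {set V}}).

Lemma star_free_deg H k : is_pairs H -> (forall v, deg H v < k) -> fan_free H 1 k.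
Proof.
move=> pH dH v Q [tQ fQ]; apply: leq_ltn_trans (dH v); rewrite deg_nbr //.
apply: leq_hitting tQ _ => K /fQ[/eqP/cards1P[u ->] vu cl].
exists u; rewrite ?set11 // inE; apply: cl; rewrite ?setU11 ?setU1r ?set11 //.
by apply: contraNneq vu => ->; rewrite set11.
Qed.

Lemma deg_star_free H k v : is_pairs H -> fan_free H 1 k -> deg H v < k.
Proof.
move=> pH fH; pose Q := [set [set u] | u in nbr H v].
have -> : deg H v = #|Q| by rewrite deg_nbr // card_imset //; apply: set1_inj.
apply: (fH v); split.
  apply: trivIset_intro => A B x /imsetP[a _ ->] /imsetP[b _ ->].
  by move=> /set1P<- /set1P<-.
move=> _ /imsetP[u vu' ->]; have vu : adj H v u by move: vu'; rewrite inE.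
split; [exact: cards1 | by rewrite in_set1 (adj_neq pH vu) | ].
move=> x y /setU1P[->|/set1P->] /setU1P[->|/set1P->] nxy; rewrite ?eqxx // in nxy *.
by rewrite adjC.
Qed.

(** In a largest graph of maximum degree less than [k], the vertices of degree
less than [k.-1] are pairwise adjacent, so there are fewer than [k] of them. *)
Lemma large_star_free k : 0 < k -> exists H, [/\ is_pairs H,
  forall v, deg H v < k & (#|V| - k.-1) * k.-1 <= 2 * #|H|].
Proof.
move=> k0; pose ok H := (H \subset pairs_in setT) && [forall v, deg H v < k].
have ok0 : ok set0.
  rewrite /ok sub0set; apply/forallP => v; rewrite /deg.
  by rewrite (_ : [set _ in _ | _] = set0) ?cards0 //; apply/setP => e; rewrite !inE.
case: (arg_maxnP (fun H : {set {set V}} => #|H|) ok0) => H /andP[sH /forallP dH] Hmax.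
have pH := sub_pairs sH; exists H; split=> //.
pose L := [set v | deg H v < k.-1].
have cL v : v \in L -> L :\ v \subset nbr H v.
  move=> vL; apply/subsetP => u /setD1P[nuv uL]; rewrite inE; apply: contraT => nvu.
  suff /Hmax : ok ([set v; u] |: H) by rewrite /geq /= cardsU1 nvu ltnn.
  rewrite /ok subUset sH sub1set inE cards2 [v == u]eq_sym nuv subsetT /=.
  apply/forallP => x; have [xvu|xvu] := boolP (x \in [set v; u]); last first.
    apply: leq_ltn_trans (dH x); apply/subset_leq_card/subsetP => e.
    rewrite inE => /andP[/setU1P[->|He] xe]; first by rewrite xe in xvu.
    by rewrite inE He.
  have xL : deg H x < k.-1 by case/set2P: xvu => ->; move: vL uL; rewrite !inE.
  apply: (@leq_ltn_trans (deg H x).+1); last by rewrite -(prednK k0) ltnS.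
  rewrite -add1n -(cards1 [set v; u]); apply: leq_trans (card_setU_le _ _).
  apply/subset_leq_card/subsetP => e; rewrite inE => /andP[/setU1P[->|He] xe].
    by rewrite setU11.
  by rewrite !inE He xe orbT.
have leL : #|L| <= k.-1.
  have [->|[v vL]] := set_0Vmem L; first by rewrite cards0.
  rewrite (cardsD1 v) vL; move: (vL); rewrite inE; apply: leq_ltn_trans.
  by rewrite deg_nbr // subset_leq_card // cL.
rewrite -handshake // (bigID (mem L)) /=.
apply: leq_trans (leq_addl _ _).
apply: (@leq_trans (\sum_(v | v \notin L) k.-1)); last first.
  by apply: leq_sum => v; rewrite inE -leqNgt.
rewrite sum_nat_const leq_mul2r; apply/orP; right.
have -> : #|[pred v | v \notin L]| = #|~: L| by apply: eq_card => v; rewrite !inE.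
by rewrite cardsCs setCK leq_sub2l.
Qed.

End Stars.

Section StarColoring.
Variables (V C : finType) (c : {set V} -> C) (k X : nat).
Hypothesis k0 : 0 < k.
Hypothesis no_rainbow : forall E : {set {set V}},
  is_pairs E -> {in E &, injective c} -> fan_free E 1 k.+1.
Hypothesis ex_bound : forall H : {set {set V}},
  is_pairs H -> fan_free H 1 k -> #|H| <= X.
Hypothesis large : 256 * (k + 1) ^ 5 * 2 ^ 16 <= #|V|.

Let P : {set {set V}} := pairs_in setT.
Let used := c @: P.
Definition star_colors v := c @: [set e in P | v \in e].
Definition seeing g := [set v | g \in star_colors v].

Let pP : is_pairs P. Proof. by move=> e; rewrite inE => /andP[/eqP]. Qed.

Lemma star_colors_le v : #|star_colors v| <= k.
Proof.
have [G [sG injG cG]] := representatives [set e in P | v \in e] c.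
have pG : is_pairs G by move=> e /(subsetP sG); rewrite inE => /andP[/pP].
rewrite /star_colors -cG card_in_imset // -ltnS.
have <- : deg G v = #|G|.
  apply: eq_card => e; rewrite inE; case: (boolP (e \in G)) => //= /(subsetP sG).
  by rewrite inE => /andP[].
exact: deg_star_free pG (no_rainbow pG injG).
Qed.

(** A graph with one edge of each of the other colours has more than [X] edges, hence
a star with [k] edges; its centre sees these [k] colours and no other one. *)
Lemma missed_vertex g : X + 2 <= #|used| -> exists v, v \notin seeing g.
Proof.
move=> many; have [G [sG injG cG]] := representatives P c.
have pG : is_pairs G by move=> e /(subsetP sG)/pP.
pose H := [set e in G | c e != g].
have pH : is_pairs H by move=> e; rewrite inE => /andP[/pG].
have cH : X < #|H|.
  have : #|G| <= #|H| + 1.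
    rewrite -(cardsID [set e | c e != g] G); apply: leq_add.
      by apply/subset_leq_card/subsetP => e; rewrite !inE.
    apply/card_le1_eqP => e f; rewrite !inE !negbK => /andP[/eqP ce Ge] /andP[/eqP cf Gf].
    by apply: injG => //; rewrite ce cf.
  move: many; rewrite /used -cG card_in_imset // => h1 h2.
  by have := leq_trans h1 h2; rewrite addn2 addn1.
have /existsP[v kv] : [exists v, k <= deg H v].
  apply: contraT; rewrite negb_exists => /forallP small.
  have : fan_free H 1 k.
    by apply: star_free_deg => // v; rewrite ltnNge.
  by move/(ex_bound pH); rewrite leqNgt cH.
exists v; rewrite inE; apply/negP => gv.
have := star_colors_le v; rewrite leqNgt => /negP[].
apply: leq_ltn_trans kv _.
pose D := c @: [set e in H | v \in e].
have -> : deg H v = #|D|.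
  rewrite /D card_in_imset // => e f; rewrite !inE.
  by move=> /andP[/andP[Ge _] _] /andP[/andP[Gf _] _]; apply: injG.
apply: proper_card; apply/properP; split.
  apply/imsetS/subsetP => e; rewrite !inE => /andP[/andP[/(subsetP sG) Pe _] ->].
  by rewrite andbT; move: Pe; rewrite inE.
exists g => //; apply/imsetP => -[e]; rewrite !inE => /andP[/andP[_ /eqP ne] _].
by move/esym.
Qed.

Lemma seeing_ge2 g : g \in used -> 2 <= #|seeing g|.
Proof.
case/imsetP=> e Pe ->; rewrite -(pP Pe); apply/subset_leq_card/subsetP => v ve.
by rewrite inE; apply: imset_f; rewrite inE Pe.
Qed.

Lemma sum_seeing : \sum_(g in used) #|seeing g| <= #|V| * k.
Proof.
apply: (@leq_trans (\sum_v #|star_colors v|)); last first.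
  by rewrite -sum_nat_const; apply: leq_sum => v _; apply: star_colors_le.
have E g : #|seeing g| = \sum_v (g \in star_colors v).
  by rewrite -sum1_card big_mkcond; apply: eq_bigr => v _; rewrite inE; case: (_ \in _).
rewrite (eq_bigr _ (fun g _ => E g)) exchange_big /=; apply: leq_sum => v _.
by rewrite sum_mem_card; apply/subset_leq_card/subsetIr.
Qed.

Lemma sum_pairs : #|V| * #|V|.-1 <= \sum_(g in used) #|seeing g| * #|seeing g|.-1.
Proof.
rewrite -cardsT -card_all_pairs -[X in 2 * X]sum1_card big_distrr /=.
rewrite (partition_big c (mem used)) /=; last by move=> e Pe; apply: imset_f.
apply: leq_sum => g _; rewrite sum_nat_cond_const mulnC.
rewrite -card_all_pairs leq_mul2l; apply/orP; right.
apply/subset_leq_card/subsetP => e; rewrite inE => /andP[Pe /eqP ce].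
rewrite inE (pP Pe) eqxx; apply/subsetP => v ve; rewrite inE -ce.
by apply: imset_f; rewrite inE Pe.
Qed.

(** The [#|V|.-1] edges at [v] have at most [k] colours. *)
Lemma popular_star v : exists g, g \in star_colors v /\ #|V| <= k * #|seeing g|.
Proof.
have nV : #|V|.-1 <= \sum_(g in star_colors v) #|seeing g|.-1.
  have -> : #|V|.-1 = #|[set e in P | v \in e]|.
    have := deg_nbr v pP; rewrite /deg => ->.
    rewrite -cardsT (cardsD1 v) inE add1n /=; apply: eq_card => u.
    rewrite in_setD1 [u == v]eq_sym in_setT in_set /adj in_set cards2 subsetT.
    by case: (v == u).
  rewrite -sum1_card (partition_big c (mem (star_colors v))) /=; last first.
    by move=> e Pe; apply: imset_f.
  apply: leq_sum => g gv; rewrite sum_nat_cond_const muln1.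
  rewrite (cardsD1 v (seeing g)) inE gv add1n /=.
  pose B := [set e in P | (v \in e) && (c e == g)].
  have pB : is_pairs B by move=> e; rewrite inE => /andP[/pP].
  apply: (@leq_trans (deg B v)).
    by apply/subset_leq_card/subsetP => e; rewrite !inE -!andbA => /and4P[-> -> -> ->].
  rewrite deg_nbr //; apply/subset_leq_card/subsetP => u; rewrite inE => vu.
  rewrite in_setD1 eq_sym (adj_neq pB vu) inE; move: vu; rewrite /adj inE.
  case/and3P=> Pvu _ /eqP <-; apply: imset_f; by rewrite inE Pvu set22.
have n0 : 0 < #|V| by apply/card_gt0P; exists v.
have [g gv big] : exists2 g, g \in star_colors v & #|V|.-1 <= k * #|seeing g|.-1.
  have [g /andP[gv big]|none] := pickP [pred g | (g \in star_colors v) &&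
      (#|V|.-1 <= k * #|seeing g|.-1)]; first by exists g.
  have V1 : 0 < #|V|.-1.
    rewrite -ltnS prednK //; apply: leq_trans large.
    have pos5 : 0 < (k + 1) ^ 5 by rewrite expn_gt0 addn1.
    have pos16 : 0 < 2 ^ 16 by rewrite expn_gt0.
    exact: (leq_mul (leq_mul (isT : 2 <= 256) pos5) pos16).
  exfalso; suff : k * #|V|.-1 < k * #|V|.-1 by rewrite ltnn.
  apply: (@leq_ltn_trans (\sum_(g in star_colors v) k * #|seeing g|.-1)).
    by rewrite -big_distrr /= leq_mul2l nV orbT.
  apply: (@leq_ltn_trans (#|star_colors v| * #|V|.-2)).
    rewrite -sum_nat_const; apply: leq_sum => g gv; have := none g.
    by rewrite /= gv /= => /negbT; rewrite -ltnNge; move: V1; case: #|V| => [|[|n]].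
  apply: (@leq_ltn_trans (k * #|V|.-2)).
    by rewrite leq_mul2r star_colors_le orbT.
  by rewrite ltn_mul2l k0; move: V1; case: #|V| => [|[|n]] /=.
exists g; split=> //; have s0 : 0 < #|seeing g|.
  by apply/card_gt0P; exists v; rewrite inE.
move: #|V| #|seeing g| s0 n0 big => n s s0 n0 big.
by have -> : k * s = k * s.-1 + k; [rewrite -mulnSr prednK | move: k0; lia].
Qed.

(** If the colour seen by most vertices, [a] of them, is not seen by a vertex, then a
second colour is seen by [y] vertices, a fraction of them. The sum [S] of these
numbers minus 2 is at most about [n], so [a] is less than [n] by about [y]; then
the colours have too few edges. *)
Lemma star_count n a y M S : 256 * (k + 1) ^ 5 * 2 ^ 16 <= n ->
  n * n.-1 <= 2 * M + (a + 1) * S -> S + 2 * M <= n * k ->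
  (n - k.-1) * k.-1 + 4 <= 2 * M -> a - 2 + (y - 2) <= S -> n <= k * y -> False.
Proof.
move=> ln h1 h2 h3 h4 h5.
have big : 1000 * (k * k * k * k + k * k * k + k * k + k + 1) <= n.
  apply: leq_trans ln; have -> : (k + 1) ^ 5 = (k+1) * ((k+1) * ((k+1) * ((k + 1) * (k+1)))).
    by rewrite !expnS expn0 muln1.
  by clear; nia.
have SD : S <= n + k * k by move: k0 h2 h3 big; clear; case: k => // k' _ /=; nia.
have ay : a + y <= n + k * k + 4 by move: h4 SD; clear; lia.
have nk : n * n <= n * k + n + (a + 1) * (n + k * k).
  have : (a + 1) * S <= (a + 1) * (n + k * k) by rewrite leq_mul2l SD orbT.
  by move: h1 h2 big; clear; case: n => //= n; nia.
have : k * (n * n) <= k * (n * k + n + (a + 1) * (n + k * k)) by rewrite leq_mul2l nk orbT.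
have : k * ((a + y) * (n + k * k)) <= k * ((n + k * k + 4) * (n + k * k)).
  by rewrite leq_mul2l leq_mul2r ay !orbT.
have : n * (n + k * k) <= k * y * (n + k * k) by rewrite leq_mul2r h5 orbT.
have : 1000 * (k * k * k * k + k * k * k + k * k + k + 1) * n <= n * n.
  by rewrite leq_mul2r big orbT.
have : 1000 * (k * k * k * k + k * k * k + k * k + k + 1) * k <= n * k.
  by rewrite leq_mul2r big orbT.
have : 0 < n by move: big; clear; lia.
move: big; clear; lia.
Qed.

Theorem star_colors_bound : #|used| <= X + 1.
Proof.
rewrite leqNgt -addnS; apply/negP => many.
have [H [pH dH cH]] := large_star_free V k0.
have HX := ex_bound pH (star_free_deg pH dH).
have /card_gt0P[g0 g0u] : 0 < #|used| by apply: leq_trans many; rewrite addn2.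
case: (arg_maxnP (fun g => #|seeing g|) g0u) => g gu gmax.
have [v vg] := missed_vertex g many.
have [g1 [g1v big1]] := popular_star v.
have g1u : g1 \in used.
  by case/imsetP: g1v => e; rewrite inE => /andP[Pe _] ->; apply: imset_f.
have g1g : g1 != g.
  by apply: contraNneq vg => <-; rewrite inE.
have sum2 : \sum_(h in used) #|seeing h| = \sum_(h in used) (#|seeing h| - 2) + 2 * #|used|.
  rewrite mulnC -sum_nat_const -big_split /=; apply: eq_bigr => h hu.
  by rewrite subnK // seeing_ge2.
apply: (@star_count #|V| #|seeing g| #|seeing g1| #|used|
          (\sum_(h in used) (#|seeing h| - 2)) large _ _ _ _ big1).
- apply: leq_trans sum_pairs _; rewrite mulnC -[in leqRHS]sum_nat_const.
  rewrite [in leqRHS]big_distrr -big_split /=; apply: leq_sum => h hu.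
  have := seeing_ge2 hu; have : #|seeing h| <= #|seeing g| := gmax h hu.
  move: #|seeing h| #|seeing g| => x y; clear => xy x2.
  have [z ez] : exists z, x = z + 2 by exists (x - 2); lia.
  by rewrite ez addnK addn2 /=; move: xy; rewrite ez; nia.
- by rewrite -sum2 sum_seeing.
- apply: leq_trans (_ : 2 * X + 4 <= _); last by rewrite -[4]/(2 * 2) -mulnDr leq_mul2l many.
  by rewrite leq_add2r (leq_trans cH) // leq_mul2l HX.
rewrite (bigD1 g) //= (bigD1 g1) /= ?g1u //.
by rewrite leq_add2l leq_addr.
Qed.

End StarColoring.

(** * The two bounds on the anti-Ramsey number *)

Section AntiRamsey.
Variables (n k r : nat).
Hypotheses (k0 : 0 < k) (r1 : 1 < r).
Hypothesis large : 256 * (k + 1) ^ 5 * r ^ 16 <= n.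

Lemma ex_ge (H : {set {set 'I_n}}) :
  is_pairs H -> fan_free H r.-1 k -> #|H| <= ex n (fan k r).
Proof.
move=> pH fH; have sH : H \subset [set e : {set 'I_n} | #|e| == 2].
  by apply/subsetP => e /pH; rewrite inE => ->.
exact: (bigmax_sup (SGraph sH)) (fan_free_contains (H := SGraph sH) r1 fH) _.
Qed.

Lemma complete_contains : contains (complete 'I_n) (fan k r).
Proof.
have le_n : #|{: option ('I_k * 'I_r.-1)}| <= n.
  rewrite card_option card_prod !card_ord; apply: leq_trans large.
  have h1 : k < 256 * (k + 1) ^ 5.
    rewrite -addn1; apply: (@leq_trans ((k + 1) ^ 5)); last by rewrite leq_pmull.
    by rewrite -{1}[k + 1]expn1 leq_pexp2l // addn1.
  have h2 : r.-1 <= r ^ 16.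
    by apply: leq_trans (leq_pred r) _; rewrite -{1}[r]expn1 leq_pexp2l // ltnW.
  apply: (@leq_trans (k.+1 * r ^ 16)); last by rewrite leq_mul2r h1 orbT.
  rewrite mulSn -add1n leq_add ?leq_mul2l ?h2 ?orbT //.
  by rewrite expn_gt0 ltnW.
pose f := [ffun x : option ('I_k * 'I_r.-1) => widen_ord le_n (enum_rank x)].
have f_inj : injective f.
  move=> x y; rewrite !ffunE => /(congr1 val) /= exy.
  exact/enum_rank_inj/val_inj.
apply/existsP; exists f; apply/andP; split; first exact/injectiveP.
apply/subsetP => _ /imsetP[e Ee ->]; rewrite inE card_imset //.
by move: Ee; rewrite inE => /andP[].
Qed.

(** Colour [m.-1] edges of an extremal graph with distinct colours and all the
other pairs with one more colour: a rainbow fan has at most one edge of the latter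
colour, and loses one clique with it. *)
Lemma forcing_ge m : forces_rainbow n (fan k.+1 r) m -> ex n (fan k r) + 2 <= m.
Proof.
case/andP=> m0 /forallP force; rewrite leqNgt addn2 ltnS; apply/negP => mX.
have [H nH cH] : exists2 H : sgraph 'I_n, ~~ contains H (fan k r) & #|H| = ex n (fan k r).
  have s0 : (set0 : {set {set 'I_n}}) \subset [set e : {set 'I_n} | #|e| == 2].
    by rewrite sub0set.
  have ne : 0 < #|[pred H : sgraph 'I_n | ~~ contains H (fan k r)]|.
    apply/card_gt0P; exists (SGraph s0); apply: fan_free_contains => // v Q [_ fQ].
    rewrite ltnNge; apply/negP => kQ.
    have /card_gt0P[K KQ] : 0 < #|Q| := leq_trans k0 kQ.
    have [cK vK cl] := fQ _ KQ.
    have /card_gt0P[x xK] : 0 < #|K| by rewrite cK -subn1 subn_gt0.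
    have nvx : v != x by apply: contraNneq vK => ->.
    by have := cl v x (setU11 _ _) (setU1r _ xK) nvx; rewrite /adj inE.
  by have [H nH eH] := eq_bigmax_cond (fun H : sgraph 'I_n => #|H|) ne; exists H.
have [S sS cS] : exists2 S : {set {set 'I_n}}, S \subset H & #|S| = m.-1.
  by apply: subfamily_of_card; rewrite cH -ltnS prednK.
case: m m0 mX cS force => // m _ mX cS force.
pose c : {ffun {set 'I_n} -> 'I_m.+1} :=
  [ffun e => if e \in S then inord (index e (enum S)).+1 else ord0].
have cE e : e \in S -> c e = (index e (enum S)).+1 :> nat.
  by move=> Se; rewrite ffunE Se inordK // ltnS -[m]cS cardE index_mem mem_enum.
have c0 e : e \notin S -> c e = ord0 by move=> /negPf nSe; rewrite ffunE nSe.
have exact_c : exact_coloring c.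
  apply/eqP/setP => j; rewrite inE; case: (posnP j) => [j0|j0].
    have [e Ke nSe] : exists2 e, e \in edges (complete 'I_n) & e \notin S.
      apply/subsetPn; apply: contra nH => sKS.
      have /existsP[f /andP[f_inj sf]] := complete_contains.
      apply/existsP; exists f; rewrite /is_copy f_inj /=.
      exact: subset_trans sf (subset_trans sKS sS).
    by apply/imsetP; exists e => //; rewrite c0 //; apply: val_inj.
  have jm : j.-1 < size (enum S).
    by rewrite -cardE cS /= -ltnS prednK.
  have Se : nth set0 (enum S) j.-1 \in S by rewrite -mem_enum mem_nth.
  apply/imsetP; exists (nth set0 (enum S) j.-1).
    by have := subsetP (edges_pairs H) _ (subsetP sS _ Se).
  by apply: val_inj; rewrite /= cE // index_uniq ?enum_uniq // prednK.
have /(rainbowP _ _ r1)[E [pE cEinj [v [Q [[tQ fQ] kQ]]]]] := implyP (force c) exact_c.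
pose Q' := [set K in Q |
  [forall x in v |: K, forall y in v |: K, (x != y) ==> adj S x y]].
have bad K : K \in Q :\: Q' -> exists e, [/\ e \in E, c e = ord0, e \subset v |: K & #|e| = 2].
  rewrite !inE => /andP[+ KQ]; rewrite KQ /= => /forall_inPn[x xK /forall_inPn[y yK]].
  rewrite negb_imply => /andP[nxy nS]; have [_ _ cl] := fQ _ KQ.
  exists [set x; y]; split; first exact: cl.
  - exact: c0.
  - by rewrite subUset !sub1set xK yK.
  by rewrite cards2 nxy.
have le1 : #|Q :\: Q'| <= 1.
  apply/card_le1_eqP => K K' KQ KQ'.
  have [e [Ee ce eK e2]] := bad _ KQ; have [e' [Ee' ce' eK' _]] := bad _ KQ'.
  have ee' : e = e' by apply: cEinj => //; rewrite ce ce'.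
  have [z ze zv] : exists2 z, z \in e & z != v.
    have /cards2P[a [b [nab ->]]] : #|e| == 2 by rewrite e2.
    have [eav|nav] := eqVneq a v; last by exists a; rewrite ?set21.
    by exists b; rewrite ?set22 // -eav eq_sym.
  have zK : z \in K by have := subsetP eK _ ze; rewrite in_setU1 (negPf zv).
  have zK' : z \in K'.
    by rewrite ee' in ze; have := subsetP eK' _ ze; rewrite in_setU1 (negPf zv).
  move: KQ KQ' => /setDP[KQ _] /setDP[KQ' _].
  exact: trivIset_eq tQ KQ' KQ zK' zK.
case/negP: nH; apply/(contains_fanP _ _ r1); exists v, Q'; split; last first.
  have := cardsID Q' Q; have := subset_leq_card (subsetIr Q Q').
  by move: kQ le1; move: #|Q| #|Q'| #|Q :&: Q'| #|Q :\: Q'|; clear; lia.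
have sQ' : Q' \subset Q by apply/subsetP => K; rewrite inE => /andP[].
apply: (@fan_atS _ S H) => //; split; first exact: trivIsetS tQ.
move=> K /[dup] /(subsetP sQ') /fQ[cK vK _]; rewrite inE => /andP[_ /clique_inP cl].
by split.
Qed.

Lemma forces_rainbow_ex : forces_rainbow n (fan k.+1 r) (ex n (fan k r) + 2).
Proof.
rewrite /forces_rainbow addn2 /=; apply/forallP => c; apply/implyP => /eqP ex_c.
apply: contraT => noR.
have no_rainbow (E : {set {set 'I_n}}) : is_pairs E -> {in E &, injective c} ->
    fan_free E r.-1 k.+1.
  move=> pE cE v Q fQ; rewrite ltnNge; apply: contra noR => kQ.
  by apply/(rainbowP _ _ r1); exists E; split=> //; exists v, Q.
have allE : pairs_in setT = edges (complete 'I_n).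
  by apply/setP => e; rewrite !inE subsetT andbT.
have colE : #|c @: pairs_in setT| = ex n (fan k r) + 2.
  by rewrite allE ex_c cardsT card_ord addn2.
suff : #|c @: pairs_in setT| <= ex n (fan k r) + 1 by rewrite colE leq_add2l.
have [r2|r2] := eqVneq r 2.
  apply: (@star_colors_bound 'I_n _ c k _ k0).
  - by move=> E pE cE; have := no_rainbow E pE cE; rewrite r2.
  - by move=> H pH fH; apply: ex_ge => //; rewrite r2.
  by rewrite card_ord; move: large; rewrite r2.
apply: (@colors_bound 'I_n _ c r.-1 k _) => //.
- by move: r1 r2; case: r => [|[|[|]]].
- exact: ex_ge.
by rewrite card_ord [r.-1 + 1]addn1 prednK // ltnW.
Qed.

End AntiRamsey.

Theorem theorem1 (n k r : nat) (hk : 1 <= k) (hr : 2 <= r)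
    (hn : 256 * (k + 1) ^ 5 * r ^ 16 <= n) :
  ar n (fan (k + 1) r) = ex n (fan k r) + 2.
Proof.
rewrite addn1 /ar; case: ex_minnP => m force minm; apply/eqP.
rewrite eqn_leq (forcing_ge hk hr hn force) andbT.
exact/minm/forces_rainbow_ex.
Qed.
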